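(* Let $K=\mathbb C(x)$ with derivation $\partial_x$, let $V\in\mathbb C[x]$ be a monic polynomial of degree $k>0$, let $\lambda\in\mathbb C$, and consider the Schrödinger equation $\partial_x^2\Psi=(V(x)-\lambda)\Psi$ with Picard–Vessiot extension $L_\lambda$ over $K$. Then $\mathrm{DGal}(L_\lambda/K)$ is either $\mathrm{SL}(2,\mathbb C)$ or the Borel group $\mathbb B$, and in both cases the eigenring of $H-\lambda=-\partial_x^2+V-\lambda$ is trivial (equal to $\mathbb C$). Moreover, $\mathrm{DGal}(L_\lambda/K)=\mathbb B$ if and only if all of the following hold: (1) $k=2n$ is even, and $V-\lambda$ is written (uniquely) as $V(x)-\lambda=\big(x^n+\sum_{j=0}^{n-1}a_jx^j\big)^2+\sum_{j=0}^{n-1}b_jx^j$ with $a_j,b_j\in\mathbb C$; (2) either $b_{n-1}-n=2m$ or $-b_{n-1}-n=2m$ for some integer $m\ge 0$; (3) correspondingly, there exists a monic polynomial $P_m\in\mathbb C[x]$ of degree $m$ satisfying, in the first case, $$\partial_x^2P_m+2\Big(x^n+\sum_{j=0}^{n-1}a_jx^j\Big)\partial_xP_m+\Big(nx^{n-1}+\sum_{j=0}^{n-2}(j+1)a_{j+1}x^j-\sum_{j=0}^{n-1}b_jx^j\Big)P_m=0,$$ or, in the second case, $$\partial_x^2P_m-2\Big(x^n+\sum_{j=0}^{n-1}a_jx^j\Big)\partial_xP_m-\Big(nx^{n-1}+\sum_{j=0}^{n-2}(j+1)a_{j+1}x^j+\sum_{j=0}^{n-1}b_jx^j\Big)P_m=0.$$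 In that situation $\Psi=P_m e^{f}$ (first case) respectively $\Psi=P_me^{-f}$ (second case) is a solution, where $f(x)=\frac{x^{n+1}}{n+1}+\sum_{j=0}^{n-1}\frac{a_jx^{j+1}}{j+1}$.
   Context: $\mathbb B=\left\{\begin{pmatrix}c&d\\0&c^{-1}\end{pmatrix}: c\in\mathbb C^*,d\in\mathbb C\right\}$. The differential Galois group is regarded as an algebraic subgroup of $\mathrm{SL}(2,\mathbb C)$ (up to conjugation). The eigenring of a second-order operator $\mathfrak L\in K[\partial_x]$ is the $\mathbb C$-algebra of operators $\mathfrak R\in K[\partial_x]$ of order $<2$ such that $\mathfrak L\mathfrak R=\mathfrak S\mathfrak L$ for some $\mathfrak S\in K[\partial_x]$ (equivalently, operators mapping the solution space of $\mathfrak L$ into itself); it is trivial if it consists only of constants. *)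

(* Defs.v *)
From HB Require Import structures.
From mathcomp Require Import all_boot all_order all_algebra.
Set Implicit Arguments. Unset Strict Implicit. Unset Printing Implicit Defensive.
Import Order.TTheory GRing.Theory Num.Theory.
Local Open Scope ring_scope.

Definition is_derivation (L : fieldType) (D : L -> L) : Prop :=
  (forall a b, D (a + b) = D a + D b) /\ (forall a b, D (a * b) = D a * b + a * D b).

Definition subfield_pred (L : fieldType) (S : L -> Prop) : Prop :=
  (forall a b, S a -> S b -> S (a - b)) /\ (forall a b, S a -> S b -> S (a * b)) /\
  (forall a, S a -> S a^-1).

(* (L, D) is a Picard-Vessiot extension of K = C(x) (embedded in L via iota and
   the element x with D x = 1) for the equation Psi'' = W Psi, with fundamental
   system (y1, y2). *)
Definition PV_ext (C : numClosedFieldType) (L : fieldType) (iota : {rmorphism C -> L})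
    (D : L -> L) (x W y1 y2 : L) : Prop :=
  is_derivation D /\ D x = 1 /\ (forall c, D (iota c) = 0) /\
  D (D y1) = W * y1 /\ D (D y2) = W * y2 /\
  y1 * D y2 - D y1 * y2 != 0 /\
  (forall z, D z = 0 -> exists c, z = iota c) /\
  (forall S : L -> Prop, subfield_pred S -> (forall c, S (iota c)) -> S x ->
     S y1 -> S y2 -> S (D y1) -> S (D y2) -> forall z, S z).

Definition inK (C : numClosedFieldType) (L : fieldType) (iota : {rmorphism C -> L})
    (x z : L) : Prop :=
  exists p q : {poly C}, q != 0 /\ z = (map_poly iota p).[x] / (map_poly iota q).[x].

(* The differential Galois group, as a set of 2x2 matrices w.r.t. the fundamental
   system (y1, y2): sigma (y1, y2) = (y1, y2) M. *)
Definition galmat (C : numClosedFieldType) (L : fieldType) (iota : {rmorphism C -> L})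
    (D : L -> L) (x y1 y2 : L) (M : 'M[C]_2) : Prop :=
  exists s : {rmorphism L -> L}, bijective s /\ (forall z, s (D z) = D (s z)) /\
    s x = x /\ (forall c, s (iota c) = iota c) /\
    s y1 = y1 * iota (M ord0 ord0) + y2 * iota (M ord_max ord0) /\
    s y2 = y1 * iota (M ord0 ord_max) + y2 * iota (M ord_max ord_max).

Definition SL2 (C : numClosedFieldType) : pred 'M[C]_2 := fun A => \det A == 1.
Definition Borel (C : numClosedFieldType) : pred 'M[C]_2 :=
  fun A => (\det A == 1) && (A ord_max ord0 == 0).

Definition conj_to (C : numClosedFieldType) (G : 'M[C]_2 -> Prop) (H : pred 'M[C]_2) : Prop :=
  exists P : 'M[C]_2, P \in unitmx /\
    forall M, G M <-> exists2 A, H A & M = invmx P *m A *m P.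

(* Composition in the ring of differential operators L[d], operators being
   represented by the polynomial of their coefficients (coefficient i of d^i):
   (a d^i)(b d^j) = sum_k C(i,k) a b^(k) d^(i+j-k). *)
Definition opmul (L : fieldType) (D : L -> L) (P Q : {poly L}) : {poly L} :=
  \sum_(i < size P) \sum_(j < size Q) \sum_(k < i.+1)
     (('C(i, k))%:R * P`_i * iter k D Q`_j) *: 'X^(i + j - k).

Definition eigenring_trivial (C : numClosedFieldType) (L : fieldType)
    (iota : {rmorphism C -> L}) (D : L -> L) (x : L) (Lop : {poly L}) : Prop :=
  forall R : {poly L}, (size R <= 2)%N -> (forall i, inK iota x R`_i) ->
    (exists S : {poly L}, (forall i, inK iota x S`_i) /\ opmul D Lop R = opmul D S Lop) ->
    exists c, R = (iota c)%:P.

(* Conditions (2),(3), first case: b_{n-1} - n = 2m and P monic of degree m with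
   P'' + 2 A P' + (A' - B) P = 0, where A = x^n + sum a_j x^j, B = sum b_j x^j. *)
Definition case1 (C : numClosedFieldType) (n m : nat) (A B P : {poly C}) : Prop :=
  B`_n.-1 - n%:R = (2 * m)%:R /\ P \is monic /\ size P = m.+1 /\
  P^`(2) + (2%:R * A) * P^`() + (A^`() - B) * P = 0.

Definition case2 (C : numClosedFieldType) (n m : nat) (A B P : {poly C}) : Prop :=
  - B`_n.-1 - n%:R = (2 * m)%:R /\ P \is monic /\ size P = m.+1 /\
  P^`(2) - (2%:R * A) * P^`() - (A^`() + B) * P = 0.

Definition cond1 (C : numClosedFieldType) (V : {poly C}) (lam : C) (k n : nat)
    (A B : {poly C}) : Prop :=
  k = (2 * n)%N /\ A \is monic /\ size A = n.+1 /\ (size B <= n)%N /\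
  V - lam%:P = A ^+ 2 + B.

(* Main.v *)
Require Import Defs.
From HB Require Import structures.
From mathcomp Require Import all_boot all_order all_algebra.
From mathcomp Require Import boolp.
From mathcomp Require Import ring zify.
Set Implicit Arguments. Unset Strict Implicit. Unset Printing Implicit Defensive.
Import Order.TTheory GRing.Theory Num.Theory.
Local Open Scope ring_scope.

(** Write W = V - lam and K = C(x).  A polynomial P over K with
    P^d + (W - X^2) P' = - N X P encodes a binary form of degree N in (y, y') whose value on every
    solution of y'' = W y is constant.  For N > 0 there is no such P other than 0: its coefficients
    have no denominators, and the recurrence they satisfy produces leading coefficients of
    alternating sign that never vanish.

    Suppose that the logarithmic derivative y'/y of a solution is algebraic over K.  Its minimal
    polynomial q is stable under Delta = d/dx + (W - X^2) d/dX.  If q had degree n > 1, then traces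
    from K[X]/(q) to K of powers of the form (S - X)^(n-2) q(S) / q'(X) would be such forms P, so
    all powers of 1 / q'(X) would have trace zero, which is absurd.  Hence the Riccati equation
    u' = W - u^2 has a solution in K.  If it has none, then y1'/y1, y1, y2/y1 are algebraically
    independent over K for every fundamental system and the Galois group is SL(2).  If it has one,
    u, then for y1 with y1' = u y1 the elements y1, y2/y1 are still algebraically independent,
    again because an algebraic relation yields a form P, and the Galois group is the Borel group.

    An operator b d + a of the eigenring yields the quadratic form b X^2 - b' X - (a' + W b), so
    b = 0.  A rational solution of the Riccati equation is P'/P + S with P, S polynomials, and
    comparing the terms of highest degree gives conditions (1)-(3). *)

Section SubfieldType.
Variables (L : fieldType) (S : L -> Prop).

Definition subfield_bool of subfield_pred S & S 1 : {pred L} := fun z => `[< S z >].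

Hypotheses (hS : subfield_pred S) (S1 : S 1).

Lemma subfield_bool_closed : divring_closed (subfield_bool hS S1).
Proof.
have [hB [hM hV]] := hS.
split=> [|a b /asboolP ha /asboolP hb|a b /asboolP ha /asboolP hb]; apply/asboolP => //.
- exact: hB.
- by apply: hM => //; apply: hV.
Qed.

HB.instance Definition _ :=
  GRing.isDivringClosed.Build L (subfield_bool hS S1) subfield_bool_closed.

Record subfield_sort :=
  SubfieldSort { subfield_val :> L; _ : subfield_val \in subfield_bool hS S1 }.
HB.instance Definition _ := [isSub for subfield_val].
HB.instance Definition _ := [Choice of subfield_sort by <:].
HB.instance Definition _ := [SubChoice_isSubIntegralDomain of subfield_sort by <:].
HB.instance Definition _ := [SubIntegralDomain_isSubField of subfield_sort by <:].

End SubfieldType.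

Lemma subfield_type (L : fieldType) (S : L -> Prop) : subfield_pred S -> S 1 ->
  exists (k : fieldType) (j : {rmorphism k -> L}), forall z, S z <-> exists a, z = j a.
Proof.
move=> hS S1; exists (subfield_sort hS S1), (val : subfield_sort hS S1 -> L).
move=> z; split=> [hz|[a ->]]; last by apply/asboolP; exact: (valP a).
have hz' : z \in subfield_bool hS S1 by apply/asboolP.
by exists (SubfieldSort hz').
Qed.

(** * Derivations of polynomial rings *)

Definition derivation (R : nzRingType) (d : R -> R) : Prop :=
  (forall a b, d (a + b) = d a + d b) /\ (forall a b, d (a * b) = d a * b + a * d b).

Section Derivation.
Variables (R : comNzRingType) (d : R -> R).
Hypothesis hd : derivation d.

Lemma derivation0 : d 0 = 0.
Proof. by apply: (@addrI _ (d 0)); rewrite -hd.1 !addr0. Qed.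

Lemma derivation1 : d 1 = 0.
Proof. by apply: (@addrI _ (d 1)); have := hd.2 1 1; rewrite !mulr1 mul1r addr0 => <-. Qed.

Lemma derivationN a : d (- a) = - d a.
Proof. by apply: (@addrI _ (d a)); rewrite -hd.1 !subrr derivation0. Qed.

Lemma derivationB a b : d (a - b) = d a - d b.
Proof. by rewrite hd.1 derivationN. Qed.

Lemma derivation_sum (I : Type) (r : seq I) (P : pred I) (F : I -> R) :
  d (\sum_(i <- r | P i) F i) = \sum_(i <- r | P i) d (F i).
Proof. exact: (big_morph d hd.1 derivation0). Qed.

Lemma derivationMn a n : d (a *+ n) = d a *+ n.
Proof. by elim: n => [|n IH]; rewrite ?mulr0n ?derivation0 // !mulrS hd.1 IH. Qed.

Lemma derivation_nat n : d n%:R = 0.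
Proof. by rewrite derivationMn derivation1 mul0rn. Qed.

Lemma derivationX a n : d (a ^+ n.+1) = n.+1%:R * a ^+ n * d a.
Proof.
elim: n => [|n IH]; first by rewrite expr1 expr0 !mul1r.
by rewrite exprS hd.2 IH -[n.+2%:R]natr1 exprS; ring.
Qed.

Lemma map_poly_derivation : derivation (map_poly d).
Proof.
have h0 := derivation0.
split=> a b; apply/polyP=> i; rewrite ?coefD !coef_map_id0 ?coefD ?hd.1 //.
rewrite !coefM derivation_sum -big_split; apply: eq_bigr => j _ /=.
by rewrite hd.2 !coef_map_id0.
Qed.

Definition dext (c p : {poly R}) : {poly R} := map_poly d p + c * p^`().

Lemma dext_derivation c : derivation (dext c).
Proof.
split=> a b; rewrite /dext ?map_poly_derivation.1 ?map_poly_derivation.2 ?derivD ?derivM; ring.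
Qed.

Lemma coef_dext c p i : (dext c p)`_i = d p`_i + (c * p^`())`_i.
Proof. by rewrite /dext coefD coef_map_id0 ?derivation0. Qed.

Lemma dextC c a : dext c a%:P = (d a)%:P.
Proof.
rewrite /dext derivC mulr0 addr0; apply/polyP => i.
by rewrite coef_map_id0 ?derivation0 // !coefC; case: eqP; rewrite ?derivation0.
Qed.

Lemma map_poly_der_deriv p : (map_poly d p)^`() = map_poly d p^`().
Proof.
by apply/polyP => i; rewrite coef_deriv !coef_map_id0 ?derivation0 // coef_deriv derivationMn.
Qed.

Lemma dextX c : dext c 'X = c.
Proof.
rewrite /dext derivX mulr1; apply/polyP => i; rewrite coefD coef_map_id0 ?derivation0 //.
by rewrite coefX; case: eqP; rewrite ?derivation0 ?derivation1 add0r.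
Qed.

Lemma deriv_dext c p : (dext c p)^`() = dext c p^`() + c^`() * p^`().
Proof. by rewrite /dext derivD derivM map_poly_der_deriv; ring. Qed.

Lemma size_map_der (p : {poly R}) : p \is monic -> (size (map_poly d p) <= (size p).-1)%N.
Proof.
move=> hp; apply/leq_sizeP => i hi; rewrite coef_map_id0 ?derivation0 //.
have [hi'|hi'] := leqP (size p) i; first by rewrite nth_default ?derivation0.
have -> : i = (size p).-1 by lia.
by rewrite -lead_coefE (monicP hp) derivation1.
Qed.

End Derivation.

Lemma derivation_eigenX (R : comNzRingType) (d : R -> R) (a u : R) n : derivation d ->
  d a = u * a -> d (a ^+ n) = n%:R * u * a ^+ n.
Proof.
move=> hd ha; case: n => [|n]; first by rewrite expr0 !mul0r derivation1.
by rewrite derivationX // ha exprS; ring.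
Qed.

Lemma coef_dext0 (R : comNzRingType) (d : R -> R) (W : R) (p : {poly R}) : derivation d ->
  (dext d (W%:P - 'X^2) p)`_0 = d p`_0 + W * p`_1.
Proof. by move=> hd; rewrite coef_dext // mulrBl coefB coefCM coefXnM coef_deriv /= subr0. Qed.

Lemma coef_dextS (R : comNzRingType) (d : R -> R) (W : R) (p : {poly R}) i : derivation d ->
  (dext d (W%:P - 'X^2) p)`_i.+1 = d p`_i.+1 + W * (p`_i.+2 *+ i.+2) - p`_i *+ i.
Proof.
move=> hd; rewrite coef_dext // mulrBl coefB coefCM coefXnM !coef_deriv addrA; congr (_ - _).
by case: i => [|i] //=; rewrite !subSS subn0.
Qed.

Lemma coefXMS (R : nzRingType) (p : {poly R}) i : ('X * p)`_i.+1 = p`_i.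
Proof. by rewrite coefXM. Qed.

Lemma dvdp_small0 (K : fieldType) (p q : {poly K}) : (size p < size q)%N -> q %| p -> p = 0.
Proof. by move=> h; rewrite /dvdp modp_small // => /eqP. Qed.

Section Evaluation.
Variables (R : comNzRingType) (L : fieldType) (f : {rmorphism R -> L}) (v : L).

Definition evp : {poly R} -> L := horner_eval v \o map_poly f.
HB.instance Definition _ := GRing.RMorphism.on evp.

Lemma evpE p : evp p = (map_poly f p).[v]. Proof. by []. Qed.
Lemma evp0 : evp 0 = 0. Proof. exact: rmorph0. Qed.
Lemma evpD p q : evp (p + q) = evp p + evp q. Proof. exact: rmorphD. Qed.
Lemma evpB p q : evp (p - q) = evp p - evp q. Proof. exact: rmorphB. Qed.
Lemma evpM p q : evp (p * q) = evp p * evp q. Proof. exact: rmorphM. Qed.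
Lemma evpC a : evp a%:P = f a. Proof. by rewrite evpE map_polyC hornerC. Qed.
Lemma evpX : evp 'X = v. Proof. by rewrite evpE map_polyX hornerX. Qed.

Lemma evp_dext (d : R -> R) (D : L -> L) c : derivation d -> derivation D ->
  (forall a, D (f a) = f (d a)) -> D v = evp c -> forall p, D (evp p) = evp (dext d c p).
Proof.
move=> hd hD hf hv; elim/poly_ind => [|p a IH].
  by rewrite evp0 (derivation0 hD) (derivation0 (dext_derivation hd c)) evp0.
rewrite (dext_derivation hd c).1 (dext_derivation hd c).2 dextX // dextC //.
by rewrite !evpD !evpM !evpC !evpX hD.1 hD.2 IH hv hf.
Qed.

End Evaluation.

Lemma minimal_relation (K L : fieldType) (f : {rmorphism K -> L}) (v : L) (p : {poly K}) :
  p != 0 -> evp f v p = 0 ->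
  exists P : {poly K}, [/\ P \is monic, (1 < size P)%N, evp f v P = 0 &
    forall q, evp f v q = 0 -> P %| q].
Proof.
move: {2}(size p).+1 (ltnSn (size p)) => n; elim: n p => // n IH p hn p0 hp.
have [[q hq hnq]|hmin] := pselect (exists2 q, evp f v q = 0 & ~~ (p %| q)).
  apply: (IH (q %% p)) => //.
  - by apply: leq_trans (ltn_modpN0 q p0) _.
  - by rewrite -[RHS]hq {2}(divp_eq q p) evpD evpM hp mulr0 add0r.
have lp : lead_coef p != 0 by rewrite lead_coef_eq0.
have hz : evp f v ((lead_coef p)^-1 *: p) = 0 by rewrite -mul_polyC evpM hp mulr0.
have sz : size ((lead_coef p)^-1 *: p) = size p by rewrite size_scale // invr_eq0.
exists ((lead_coef p)^-1 *: p); split=> //.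
- by rewrite monicE lead_coefZ mulVf.
- rewrite ltnNge; apply/negP => /size1_polyC e; move: hz.
  rewrite e evpC => /eqP; rewrite fmorph_eq0 => /eqP e0; move: e; rewrite e0 => /eqP.
  by rewrite scaler_eq0 invr_eq0 (negPf lp) (negPf p0).
- move=> q hq; rewrite dvdpZl ?invr_eq0 //; apply/negPn/negP => hnq; apply: hmin.
  by exists q.
Qed.

Lemma evp_inj (K L : fieldType) (f : {rmorphism K -> L}) (v : L) :
  (forall P : {poly K}, P \is monic -> (1 < size P)%N -> evp f v P = 0 ->
    (forall q, evp f v q = 0 -> P %| q) -> False) -> injective (evp f v).
Proof.
move=> h p q e; apply/eqP; rewrite -subr_eq0; apply/negPn/negP => hpq.
have [|P [hP s1 z1 m1]] := minimal_relation hpq (f := f) (v := v); last exact: h P hP s1 z1 m1.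
by rewrite evpB e subrr.
Qed.

(** * Absence of rational invariant forms *)

Section LeadingTerms.
Variable F : numFieldType.
Implicit Types p q : {poly F}.

Definition top_coef p m c := (forall i, (m < i)%N -> p`_i = 0) /\ p`_m = c.

Lemma top_coefM p q m n a b : top_coef p m a -> top_coef q n b -> top_coef (p * q) (m + n) (a * b).
Proof.
move=> [hp <-] [hq <-]; split=> [i hi|]; rewrite coefM.
  rewrite big1 // => j _; have [hj|hj] := leqP j m; last by rewrite hp ?mul0r.
  by rewrite (hq (i - j)%N) ?mulr0 //; lia.
have hm : (m < (m + n).+1)%N by lia.
rewrite (bigD1 (Ordinal hm)) //= addKn big1 ?addr0 // => j nj.
have [hj|hj|hj] := ltngtP j m; last by case/negP: nj; apply/eqP/val_inj.
- by rewrite (hq (m + n - j)%N) ?mulr0 //; lia.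
- by rewrite hp ?mul0r.
Qed.

(* The coefficients of an invariant form of degree N satisfy this recurrence; the signs of the
   leading coefficients of r 0, r 2, r 4, ... alternate, those of r 3, r 5, ... do as well, hence
   none of the r i with i > 1 vanishes. *)
Lemma invariant_recurrence (N k : nat) (w : {poly F}) (r : nat -> {poly F}) :
  (0 < N)%N -> (0 < k)%N -> top_coef w k 1 -> r 0%N != 0 -> r 1%N = (r 0%N)^`() ->
  (forall i, (i < N)%N -> r i.+2 *+ i.+2 = (r i.+1)^`() - (w * r i) *+ (N - i)) ->
  r N.+1 != 0.
Proof.
move=> N0 k0 hw r0 r1 hr.
pose m := (size (r 0%N)).-1; pose c := lead_coef (r 0%N).
have c0 : c != 0 by rewrite lead_coef_eq0.
pose Ev j := exists2 a : F, 0 < a & top_coef (r j.*2) (m + j * k) (a * (-1) ^+ j * c).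
pose Od j := exists2 b : F, 0 <= b /\ ((0 < j)%N -> 0 < b) &
  top_coef ('X * r j.*2.+1) (m + j * k) (b * (-1) ^+ j * c).
have hXd p i : ('X * p^`())`_i = p`_i *+ i by case: i => [|i]; rewrite coefXM //= coef_deriv.
have hsz i : (m < i)%N -> (r 0%N)`_i = 0.
  by move=> hi; rewrite nth_default //; apply: leq_trans (leqSpred _) hi.
have hE0 : Ev 0%N.
  by exists 1 => //; rewrite addn0 expr0 !mul1r; split=> // i /hsz.
have hO0 : Od 0%N.
  exists m%:R; first by split.
  rewrite addn0 expr0 mulr1 r1; split=> [i hi|]; first by rewrite hXd hsz ?mul0rn.
  by rewrite hXd -lead_coefE mulr_natl.
have hE j : (j.*2 < N)%N -> Ev j -> Od j -> Ev j.+1.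
  move=> hj [a a0 ha] [b _ [hb _]]; have [h1 h2] := top_coefM hw ha.
  have hz i : (m + j * k <= i)%N -> (r j.*2.+1)`_i = 0.
    by move=> hi; have := hb i.+1 hi; rewrite coefXM.
  have hr' i : (r j.+1.*2)`_i *+ j.*2.+2 =
      ((r j.*2.+1)`_i.+1 *+ i.+1) - (w * r j.*2)`_i *+ (N - j.*2).
    by have := congr1 (fun p : {poly F} => p`_i) (hr _ hj);
       rewrite coefMn coefB coefMn coef_deriv doubleS.
  have e : (m + j.+1 * k = k + (m + j * k))%N by rewrite mulSn; lia.
  have n0 : (j.*2.+2)%:R != 0 :> F by rewrite pnatr_eq0.
  exists (a * (N - j.*2)%:R / j.*2.+2%:R).
    by rewrite divr_gt0 ?mulr_gt0 ?ltr0n // subn_gt0.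
  rewrite e; split=> [i hi|]; apply: (mulIf n0); rewrite [LHS]mulr_natr hr'.
    by rewrite h1 // hz ?mul0rn ?subr0 ?mul0r //; lia.
  rewrite h2 hz ?mul0rn; last by lia.
  rewrite -[X in _ - X]mulr_natr exprS; move: n0.
  by move: (j.*2.+2%:R : F) ((N - j.*2)%:R : F) => u v n0; field.
have hO j : (j.*2.+1 < N)%N -> Ev j.+1 -> Od j -> Od j.+1.
  move=> hj [a a0 [ha1 ha2]] [b [b0 _] hb]; have [h1 h2] := top_coefM hw hb.
  have hr' i : ('X * r j.+1.*2.+1)`_i *+ j.*2.+3 =
      (r j.+1.*2)`_i *+ i - (w * ('X * r j.*2.+1))`_i *+ (N - j.*2.+1).
    rewrite doubleS mulrCA -hXd -coefMn -mulrnAr hr // -coefMn -coefB; congr (_`_i).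
    by rewrite mulrBr mulrnAr.
  have e : (m + j.+1 * k = k + (m + j * k))%N by rewrite mulSn; lia.
  have n0 : (j.*2.+3)%:R != 0 :> F by rewrite pnatr_eq0.
  exists ((a * (m + j.+1 * k)%:R + b * (N - j.*2.+1)%:R) / j.*2.+3%:R).
    have p0 : 0 < a * (m + j.+1 * k)%:R + b * (N - j.*2.+1)%:R.
      rewrite ltr_pwDl ?mulr_ge0 // mulr_gt0 // ltr0n; lia.
    by split=> [|_]; rewrite ?divr_ge0 ?divr_gt0 ?ltr0n // ltW.
  split=> [i hi|]; apply: (mulIf n0); rewrite [LHS]mulr_natr hr'.
    by rewrite ha1 // h1 ?mul0rn ?subr0 ?mul0r //; rewrite -e.
  rewrite ha2 {2}e h2 exprS -[X in X - _]mulr_natr -[X in _ - X]mulr_natr; move: n0.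
  move: (j.*2.+3%:R : F) ((N - j.*2.+1)%:R : F) ((m + j.+1 * k)%:R : F) => u v t n0.
  by field.
have hall j : (j.*2 <= N)%N -> Ev j /\ Od j.
  elim: j => [//|j IH] hj; rewrite doubleS in hj.
  have [|h1 h2] := IH; first by lia.
  have h3 : Ev j.+1 by apply: hE => //; lia.
  by split=> //; apply: hO => //; lia.
have nz p i a j : a != 0 -> top_coef p i (a * (-1) ^+ j * c) -> p != 0.
  move=> a0 [_ hp]; apply: contraTneq a0 => p0; move: hp; rewrite p0 coef0 => /eqP.
  by rewrite eq_sym !mulf_eq0 (negPf c0) signr_eq0 !orbF negbK.
have [|[a a0 ha] [b [b0 b1] hb]] := hall N./2; first by have := odd_double_half N; lia.
have eN := odd_double_half N.
case oN : (odd N) in eN.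
  have [|a' a'0 ha'] := hE N./2 _ (ex_intro2 _ _ a a0 ha) (ex_intro2 _ _ b (conj b0 b1) hb).
    by lia.
  rewrite -eN addnC addn1; rewrite doubleS in ha'; apply: nz ha'; exact: lt0r_neq0.
rewrite add0n in eN; rewrite eN in hb.
have : 'X * r N.+1 != 0.
  by apply: nz hb; apply/lt0r_neq0/b1; lia.
by apply: contraNneq => ->; rewrite mulr0.
Qed.
End LeadingTerms.

Section Rational.
Variables (F : numFieldType) (K : fieldType) (e : {rmorphism {poly F} -> K}) (d : K -> K).
Hypotheses (e_inj : injective e) (hd : derivation d) (de : forall p, d (e p) = e p^`()).
Hypothesis e_frac : forall z, exists p q, q != 0 /\ z = e p / e q.

Let e0 p : (e p == 0) = (p == 0).
Proof. by rewrite -(rmorph0 e) (inj_eq e_inj). Qed.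

Let eD p q : e (p + q) = e p + e q. Proof. exact: rmorphD. Qed.
Let eN p : e (- p) = - e p. Proof. exact: rmorphN. Qed.
Let eM p q : e (p * q) = e p * e q. Proof. exact: rmorphM. Qed.
Let eMn p n : e (p *+ n) = e p *+ n. Proof. exact: rmorphMn. Qed.

Lemma common_denominator (P : {poly K}) :
  exists2 g : {poly F}, g != 0 & forall i, exists q, e g * P`_i = e q.
Proof.
elim/poly_ind: P => [|P a [g g0 IH]].
  by exists 1 => [|i]; [exact: oner_neq0|exists 0; rewrite coef0 mulr0 rmorph0].
have [p [q [q0 ->]]] := e_frac a.
exists (g * q) => [|i]; first by rewrite mulf_neq0.
rewrite coefD coefMX coefC; case: i => [|i] /=.
  by exists (g * p); rewrite add0r !rmorphM /=; field; rewrite e0.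
by have [s hs] := IH i; exists (s * q); rewrite addr0 !rmorphM /= -hs; ring.
Qed.

Lemma polynomial_invariant (w : {poly F}) (N : nat) (P : {poly K}) :
  dext d ((e w)%:P - 'X^2) P + N%:R * 'X * P = 0 ->
  forall i, exists q, P`_i = e q.
Proof.
move=> hP; have [g g0 hg] := common_denominator P.
move: {2}(size g).+1 (ltnSn (size g)) => n; elim: n g g0 hg => // n IH g g0 hg hn.
have [/size1_polyC eg|s1] := leqP (size g) 1.
  move=> i; have [q hq] := hg i; exists ((g`_0)^-1%:P * q).
  have c0 : g`_0 != 0 by move: g0; rewrite {1}eg polyC_eq0.
  apply: (mulfI (_ : e g != 0)); first by rewrite e0.
  by rewrite hq -rmorphM mulrA {1}eg -polyCM divff // mul1r.
have dg0 : g^`() != 0.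
  have /= := coef_deriv g (size g).-2.
  have -> : (size g).-2.+1 = (size g).-1 by lia.
  rewrite -lead_coefE => h; apply/eqP => dg; move/esym/eqP: h.
  rewrite dg coef0 mulrn_eq0 lead_coef_eq0 (negPf g0) orbF; lia.
have [q hq] := choice hg.
have eg : e g != 0 by rewrite e0.
have hP' i : P`_i = e (q i) / e g by rewrite -hq mulrAC divff // mul1r.
have hd' i : exists s, e g * d P`_i = e s.
  have := congr1 (fun p : {poly K} => p`_i) hP; rewrite coef0 coefD.
  rewrite -mulrA -polyC_natr coefCM; case: i => [|i].
    rewrite coef_dext0 // coefXM mulr0 addr0 => /eqP; rewrite addr_eq0 => /eqP ->.
    exists (- (w * q 1%N)); rewrite hP' rmorphN rmorphM /=; field.
    by rewrite eg.
  rewrite coef_dextS // coefXMS => h.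
  have -> : d P`_i.+1 = - (e w * (P`_i.+2 *+ i.+2)) + P`_i *+ i - N%:R * P`_i.
    by apply/eqP; rewrite -subr_eq0; apply/eqP; rewrite -[RHS]h; ring.
  exists (- (w * (q i.+2 *+ i.+2)) + q i *+ i - N%:R * q i).
  rewrite !hP' !eD !eN !eM !eMn (rmorph1 e).
  rewrite -[X in e w * X]mulr_natr -[X in _ + X - _]mulr_natr -[X in _ = - (e w * X) + _ - _]mulr_natr.
  rewrite -[X in _ = _ + X - _]mulr_natr.
  by move: (i.+2%:R : K) (i%:R : K) (N%:R : K) => a b c; field; rewrite eg.
have hdiv i : g %| q i * g^`().
  have [s hs] := hd' i.
  have : e g * (e g * d (P`_i)) = e g * d (e (q i)) - e (q i) * d (e g).
    rewrite -(hq i) hd.2; ring.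
  rewrite hs !de -!rmorphM -rmorphB => /e_inj h.
  have -> : q i * g^`() = g * ((q i)^`() - s) by rewrite mulrBr h; ring.
  by rewrite dvdp_mulr.
pose h := gcdp g g^`().
have h0 : h != 0 by rewrite gcdp_eq0 negb_and g0.
have /dvdpP[g1 eg1] : h %| g := dvdp_gcdl _ _.
have /dvdpP[g2 eg2] : h %| g^`() := dvdp_gcdr _ _.
have cop : coprimep g1 g2.
  have [u hu] := Bezoutp g g^`(); apply/Bezout_coprimepP; exists u.
  by move: hu; rewrite -/h {1}eg1 {1}eg2 !mulrA -mulrDl -{2}[h]mul1r eqp_mul2r.
have g10 : g1 != 0 by apply: contraNneq g0; rewrite eg1 => ->; rewrite mul0r.
apply: (IH h h0) => [i|].
  have : g1 %| q i.
    rewrite -(Gauss_dvdpl _ cop); have := hdiv i.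
    by rewrite {1}eg1 eg2 mulrA dvdp_mul2r.
  case/dvdpP => s hs; exists s; apply: (mulfI (_ : e g1 != 0)); first by rewrite e0.
  by rewrite mulrA -!rmorphM -eg1 hq hs mulrC.
apply: leq_ltn_trans (leq_gcdpr _ dg0) _.
by apply: leq_trans (lt_size_deriv g0) _; rewrite -ltnS.
Qed.

Lemma rational_no_invariant (w : {poly F}) (k N : nat) (P : {poly K}) :
  w \is monic -> size w = k.+1 -> (0 < k)%N -> (0 < N)%N ->
  dext d ((e w)%:P - 'X^2) P + N%:R * 'X * P = 0 -> P = 0.
Proof.
move=> mw sw k0 N0 hP; have [q hq] := choice (polynomial_invariant hP).
have eq0 i : P`_i = 0 -> q i = 0 by rewrite hq => /eqP; rewrite e0 => /eqP.
have rec i : (q i.+1)^`() + w * q i.+2 *+ i.+2 - q i *+ i + q i *+ N = 0.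
  apply: e_inj; have := congr1 (fun p : {poly K} => p`_i.+1) hP; rewrite coef0 coefD.
  rewrite -mulrA -polyC_natr coefCM coef_dextS // coefXMS !hq de rmorph0 => h; apply: etrans h.
  rewrite [LHS]eD [X in X + _]eD [X in X + _ + _]eD eN !eMn eM.
  by rewrite mulrnAr mulr_natl.
have rec0 : (q 0%N)^`() + w * q 1%N = 0.
  apply: e_inj; have := congr1 (fun p : {poly K} => p`_0) hP; rewrite coef0 coefD.
  rewrite -mulrA -polyC_natr coefCM coef_dext0 // coefXM mulr0 addr0 !hq de rmorph0 => h; apply: etrans h.
  by rewrite eD eM.
have d0 : (0 : {poly F})^`() = 0 by rewrite -polyC0 derivC.
apply/eqP/negPn/negP => P0.
pose s := (size P).-1.
have sP : size P = s.+1 by rewrite /s prednK // size_poly_gt0.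
have big i : (s < i)%N -> q i = 0 by move=> hi; apply: eq0; rewrite nth_default // sP.
have qs : q s != 0 by rewrite -e0 -hq /s -lead_coefE lead_coef_eq0.
have sN : s = N.
  have := rec s; rewrite (big s.+1) // (big s.+2) // mulr0 mul0rn d0 !add0r addrC => /eqP.
  rewrite subr_eq0.
  rewrite -[X in X == _]mulr_natr -[X in _ == X]mulr_natr => /eqP /(mulfI qs) /eqP.
  rewrite -[X in X == _]polyC_natr -[X in _ == X]polyC_natr (inj_eq (@polyC_inj F)).
  by rewrite eqr_nat => /eqP.
rewrite sN in big qs => {sN sP s}.
have hw : top_coef w k 1.
  split=> [i hi|]; first by rewrite nth_default ?sw.
  by have := monicP mw; rewrite lead_coefE sw.
pose r i := if (i <= N)%N then (-1) ^+ i * q (N - i)%N else 0.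
have hr0 i : (i <= N)%N -> r i = (-1) ^+ i * q (N - i)%N by rewrite /r => ->.
have rN : r N.+1 = 0 by rewrite /r ltnn.
have rec' i : (i <= N)%N -> q i *+ (N - i) = - ((q i.+1)^`() + w * q i.+2 *+ i.+2).
  move=> hi; have := rec i; rewrite -addrA [- _ + _]addrC -mulrnBr // addrC => /eqP.
  by rewrite addr_eq0 => /eqP.
have : r N.+1 != 0.
  apply: (@invariant_recurrence F N k w r N0 k0 hw).
  - by rewrite hr0 // subn0 mul1r.
  - have := rec' N.-1 (leq_pred N); rewrite prednK // (big N.+1) // mulr0 mul0rn addr0.
    rewrite !hr0 // subn0 subn1 expr0 expr1 mul1r mulN1r.
    by have -> : (N - N.-1 = 1)%N; [lia|rewrite mulr1n => ->; rewrite opprK].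
  - move=> i hi; have [hi2|hi2] := ltnP i.+1 N.
      have := rec' (N - i.+2)%N (leq_subr _ _).
      have -> : ((N - i.+2).+1 = N - i.+1)%N by lia.
      have -> : ((N - i.+1).+1 = N - i)%N by lia.
      have -> : (N - (N - i.+2) = i.+2)%N by lia.
      move=> h; rewrite !hr0; [|lia|lia|lia].
      rewrite -[LHS]mulrnAr h -[X in _ = _ - X]mulrnAl.
      have -> : ((-1) ^+ i.+1 * q (N - i.+1)%N)^`() = (-1) ^+ i.+1 * (q (N - i.+1)%N)^`().
        by rewrite -signr_odd; case: (odd _); rewrite ?mul1r // !mulN1r derivN.
      rewrite -[X in (-1) ^+ _ * - (_ + X)]mulrnAl; move: (w *+ _) => b.
      by rewrite !exprS; ring.
    have e1 : i.+1 = N by lia.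
    rewrite e1 rN mul0rn.
    have -> : (N - i = 1)%N by lia.
    rewrite mulr1n !hr0; [|lia|lia].
    rewrite subnn; have -> : (N - i = 1)%N by lia.
    rewrite -e1 exprS mulN1r mulNr derivN.
    have -> : ((-1) ^+ i * q 0%N)^`() = (-1) ^+ i * (q 0%N)^`().
      by rewrite -signr_odd; case: (odd _); rewrite ?mul1r // !mulN1r derivN.
    by move/eqP: rec0; rewrite addr_eq0 => /eqP ->; ring.
by rewrite rN eqxx.
Qed.
End Rational.

(** * Polynomials stable under the Riccati derivation *)

Section Stable.
Variables (K : fieldType) (d : K -> K) (W : K).
Hypotheses (hd : derivation d) (char0 : forall n, n.+1%:R != 0 :> K).
Local Notation Delta := (dext d (W%:P - 'X^2)).
Hypothesis no_invariant : forall N (P : {poly K}), (0 < N)%N ->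
  Delta P + N%:R * 'X * P = 0 -> P = 0.

Let hD : derivation Delta := dext_derivation hd _.

Section Trace.
Variables (n : nat) (q : {poly K}).
Hypotheses (mq : q \is monic) (sq : size q = n.+3).
Hypotheses (cq : coprimep q q^`()) (stq : q %| Delta q).

Let theta := q`_n.+1.
Let h := theta%:P - n.+2%:R * 'X : {poly K}.

Lemma stable_cofactor : Delta q = h * q.
Proof.
apply/eqP; rewrite -subr_eq0; apply/eqP; apply: (@dvdp_small0 _ _ q); last first.
  by rewrite dvdp_sub // dvdp_mull.
rewrite sq; apply/leq_sizeP => -[//|i] hi; rewrite coefB coef_dextS //.
have q2 : q`_n.+2 = 1 by rewrite -(monicP mq) lead_coefE sq.
have qbig k : (n.+3 <= k)%N -> q`_k = 0 by move=> hk; rewrite nth_default // sq.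
have -> : (h * q)`_i.+1 = theta * q`_i.+1 - n.+2%:R * q`_i.
  by rewrite /h mulrBl coefB coefCM -mulrA -polyC_natr coefCM coefXM.
have [e|[e|e]] : i = n.+1 \/ i = n.+2 \/ (n.+2 < i)%N by lia.
- rewrite e q2 (qbig n.+3) // (derivation1 hd) /theta; ring.
- rewrite e q2 !qbig // (derivation0 hd); ring.
- rewrite !qbig ?(derivation0 hd); [ring|lia|lia|lia].
Qed.

Definition residue (p : {poly K}) := (p %% q)`_n.+1.
Let E p := Delta p - (theta%:P - n%:R * 'X) * p.

Lemma residueD : {morph residue : a b / a + b}.
Proof. by move=> a b; rewrite /residue modpD coefD. Qed.

Lemma residue_mull p : residue (p * q) = 0.
Proof. by rewrite /residue modp_mull coef0. Qed.

Lemma residue_derivation p : d (residue p) = residue (E p).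
Proof.
have -> : residue (E p) = residue (E (p %% q)).
  rewrite {1}(divp_eq p q) /E hD.1 hD.2 stable_cofactor.
  set g := p %/ q; set r := p %% q.
  have -> : Delta g * q + g * (h * q) + Delta r - (theta%:P - n%:R * 'X) * (g * q + r) =
     (Delta g + g * h - (theta%:P - n%:R * 'X) * g) * q +
     (Delta r - (theta%:P - n%:R * 'X) * r) by ring.
  by rewrite residueD residue_mull add0r.
rewrite {1}/residue; set r := p %% q.
have sr : (size r <= n.+2)%N by rewrite -ltnS -sq ltn_modpN0 // monic_neq0.
have rbig k : (n.+2 <= k)%N -> r`_k = 0 by move=> hk; rewrite nth_default // (leq_trans sr).
have q2 : q`_n.+2 = 1 by rewrite -(monicP mq) lead_coefE sq.
have qbig k : (n.+3 <= k)%N -> q`_k = 0 by move=> hk; rewrite nth_default // sq.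
have cE i : (E r + r`_n.+1 *: q)`_i.+1 = d r`_i.+1 + W * (r`_i.+2 *+ i.+2) - r`_i *+ i
    - (theta * r`_i.+1 - n%:R * r`_i) + r`_n.+1 * q`_i.+1.
  rewrite coefD coefZ /E coefB coef_dextS //.
  by rewrite mulrBl coefB coefCM -mulrA -polyC_natr coefCM coefXM.
have -> : E r = (- r`_n.+1)%:P * q + (E r + r`_n.+1 *: q).
  by rewrite -mul_polyC polyCN; ring.
rewrite residueD residue_mull add0r /residue modp_small; last first.
  rewrite sq; apply/leq_sizeP => -[//|i] hi; rewrite cE.
  have [e|[e|e]] : i = n.+1 \/ i = n.+2 \/ (n.+2 < i)%N by lia.
  - rewrite e q2 (rbig n.+2) // (rbig n.+3) // (derivation0 hd); ring.
  - rewrite e (rbig n.+2) // (rbig n.+3) // (rbig n.+4) ?qbig ?(derivation0 hd); [ring|lia|lia].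
  - rewrite (rbig i) ?(rbig i.+1) ?(rbig i.+2) ?qbig ?(derivation0 hd); [ring|lia|lia|lia|lia].
rewrite cE (rbig n.+2) // /theta; ring.
Qed.

(* Euler's formula: this is the trace of K[X]/(q) over K. *)
Definition trace p := residue (p * q^`()).

Lemma traceD : {morph trace : a b / a + b}.
Proof. by move=> a b; rewrite /trace mulrDl residueD. Qed.

Lemma trace0 : trace 0 = 0.
Proof. by rewrite /trace mul0r /residue mod0p coef0. Qed.

Lemma traceN a : trace (- a) = - trace a.
Proof. by apply: (@addrI _ (trace a)); rewrite -traceD !subrr trace0. Qed.

Lemma traceMn a m : trace (a *+ m) = trace a *+ m.
Proof. by elim: m => [|m IH]; rewrite ?trace0 // !mulrS traceD IH. Qed.

Lemma traceC a p : trace (a%:P * p) = a * trace p.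
Proof. by rewrite /trace -mulrA mul_polyC /residue modpZl coefZ. Qed.

Lemma trace_mull p : trace (p * q) = 0.
Proof. by rewrite /trace mulrAC residue_mull. Qed.

Lemma trace1 : trace 1 = n.+2%:R.
Proof.
rewrite /trace mul1r /residue modp_small; last by rewrite lt_size_deriv // monic_neq0.
by rewrite coef_deriv -[q`_n.+2]/(q`_n.+3.-1) -sq -lead_coefE (monicP mq).
Qed.

Lemma Delta_deriv : Delta q^`() = h^`() * q + (theta%:P - n%:R * 'X) * q^`().
Proof.
have := deriv_dext hd (W%:P - 'X^2) q; rewrite stable_cofactor derivM.
have -> : (W%:P - 'X^2)^`() = - ('X *+ 2) by rewrite derivB derivC derivXn expr1 sub0r.
move/eqP; rewrite eq_sym -subr_eq => /eqP <-; rewrite /h -[n.+2]addn2 natrD; ring.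
Qed.

Lemma trace_derivation p : d (trace p) = trace (Delta p).
Proof.
rewrite /trace residue_derivation /E hD.2 Delta_deriv.
have -> : Delta p * q^`() + p * (h^`() * q + (theta%:P - n%:R * 'X) * q^`()) -
   (theta%:P - n%:R * 'X) * (p * q^`()) = Delta p * q^`() + p * h^`() * q by ring.
by rewrite residueD residue_mull addr0.
Qed.


Local Notation DD := (dext Delta ((W%:P)%:P - 'X^2)).
Let hDD : derivation DD := dext_derivation hD _.
Let x : {poly {poly K}} := ('X)%:P.

Lemma dext_map_polyC p : DD (map_poly polyC p) = map_poly polyC (Delta p).
Proof.
elim/poly_ind: p => [|p c IH]; first by rewrite !rmorph0 (derivation0 hDD) (derivation0 hD) rmorph0.
rewrite rmorphD rmorphM /= map_polyX map_polyC /= hDD.1 hDD.2 IH hD.1 hD.2 !(dextX, dextC) //.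
rewrite [RHS]rmorphD [X in _ = X + _]rmorphD [X in _ = X + _ + _]rmorphM.
rewrite [X in _ = _ + X + _]rmorphM [X in _ = _ + _ * X + _]rmorphB /=.
by rewrite map_polyX !map_polyC map_polyXn.
Qed.

Variables (a g : {poly K}).
Hypothesis bezout : a * q + g * q^`() = 1.

Lemma Delta_inverse : exists Z, Delta g = - (theta%:P - n%:R * 'X) * g + q * Z.
Proof.
have := congr1 Delta bezout; rewrite (derivation1 hD) hD.1 !hD.2 stable_cofactor Delta_deriv => e1.
exists (a * Delta g - g * Delta a - g * a * h - g * g * h^`() + (theta%:P - n%:R * 'X) * g * a).
rewrite -{1}[Delta g]mulr1 -{1}bezout.
have -> : Delta g * (a * q + g * q^`()) = g * (Delta g * q^`()) + Delta g * a * q by ring.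
have -> : Delta g * q^`() = - (Delta a * q + a * (h * q)) -
   g * (h^`() * q + (theta%:P - n%:R * 'X) * q^`()).
  by apply/eqP; rewrite -subr_eq0 -e1; apply/eqP; ring.
have e2 : g * q^`() = 1 - a * q by rewrite -bezout; ring.
transitivity (- (theta%:P - n%:R * 'X) * g * (g * q^`()) +
  (- (g * Delta a) - g * a * h - g * g * h^`() + Delta g * a) * q); first by ring.
by rewrite e2; ring.
Qed.

Let F : {poly {poly K}} := ('X - x) ^+ n * map_poly polyC q * g%:P.

Lemma invariant_mod : exists Z, DD F = - (n.*2.+2)%:R * 'X * F + q%:P * Z.
Proof.
have [Z hZ] := Delta_inverse; exists (('X - x) ^+ n * map_poly polyC q * Z%:P).
have e1 : DD (('X - x) ^+ n) = n%:R * (- ('X + x)) * ('X - x) ^+ n.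
  apply: derivation_eigenX => //.
  by rewrite (derivationB hDD) /x dextX // !dextC // dextX // polyCB polyC_exp; ring.
have e2 : DD (map_poly polyC q) = ((theta%:P)%:P - n.+2%:R * 'X) * map_poly polyC q.
  rewrite dext_map_polyC stable_cofactor /h rmorphM rmorphB rmorphM /= rmorph_nat map_polyX.
  by rewrite map_polyC.
rewrite /F !hDD.2 e1 e2 dextC // hZ !(polyCM, polyCD, polyCN, polyCB) polyC_natr -/x.
rewrite -[n.+2]addn2 -[n.*2.+2]addn2 -addnn !natrD; ring.
Qed.

Lemma trace_inverseX j : trace (g ^+ j.+1) = 0.
Proof.
have [Z hZ] := invariant_mod.
have {Z hZ} [Z hZ] : exists Z, DD (F ^+ j.+1) +
    (j.+1 * n.*2.+2)%:R * 'X * F ^+ j.+1 = q%:P * Z.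
  exists (j.+1%:R * F ^+ j * Z).
  by rewrite (derivationX hDD) hZ exprS natrM; ring.
have P0 : map_poly trace (F ^+ j.+1) = 0.
  apply: (@no_invariant (j.+1 * n.*2.+2)%N) => //.
  set G := F ^+ j.+1 in hZ *; set N := (j.+1 * _)%N in hZ *.
  have ht i : trace (DD G + N%:R * 'X * G)`_i = 0.
    by rewrite hZ coefCM mulrC trace_mull.
  have t0 := trace0.
  apply/polyP => -[|i]; rewrite coef0.
  - rewrite coefD coef_dext0 // -mulrA -!polyC_natr coefCM coefXM mulr0 addr0 !coef_map_id0 //.
    have := ht 0%N; rewrite coefD coef_dext0 // -mulrA -!polyC_natr coefCM coefXM mulr0 addr0.
    by rewrite traceD traceC -trace_derivation.
  - rewrite coefD coef_dextS // -mulrA -!polyC_natr coefCM coefXMS !coef_map_id0 //.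
    have := ht i.+1; rewrite coefD coef_dextS // -mulrA -!polyC_natr coefCM coefXMS.
    rewrite traceD [trace (_ - _)]traceD [trace (_ + _ * _)]traceD traceN traceC.
    by rewrite -trace_derivation !traceMn traceC.
have [M mM eM] : exists2 M : {poly {poly K}}, M \is monic & F ^+ j.+1 = (g ^+ j.+1) *: M.
  exists ((('X - x) ^+ n * map_poly polyC q) ^+ j.+1).
    by rewrite rpredX // rpredM ?rpredX ?monicXsubC // map_monic.
  by rewrite /F exprMn -mul_polyC polyC_exp mulrC.
have := congr1 (fun p : {poly K} => p`_(size M).-1) P0.
rewrite coef_map_id0 ?trace0 // eM coefZ -lead_coefE (monicP mM) mulr1 coef0 //.
Qed.

Lemma trace_eq_mod p r s : p = r + s * q -> trace p = trace r.
Proof. by move->; rewrite traceD trace_mull addr0. Qed.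

Lemma no_squarefree_stable : False.
Proof.
pose A : 'M[K]_(n.+3, n.+2) := \matrix_(i, l) ((q^`() ^+ i) %% q)`_l.
have : kermx A != 0.
  by rewrite -mxrank_eq0 mxrank_ker subn_eq0 -ltnNge ltnS rank_leq_col.
case/rowV0Pn => v /sub_kermxP hv v0.
pose p := \sum_(i < n.+3) (v 0 i)%:P * q^`() ^+ i.
have hp : q %| p.
  have q0 : q != 0 by rewrite monic_neq0.
  apply/eqP; apply/polyP => l; rewrite coef0.
  have [hl|hl] := leqP n.+2 l.
    by rewrite nth_default //; apply: leq_trans hl; rewrite -ltnS -sq ltn_modp.
  have := congr1 (fun B : 'rV_(n.+2) => B 0 (Ordinal hl)) hv; rewrite !mxE; move=> e; apply: etrans e.
  rewrite /p (big_morph (fun r : {poly K} => (r %% q)`_l) (id1 := 0) (op1 := +%R)).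
  - by apply: eq_bigr => i _; rewrite mul_polyC modpZl coefZ !mxE.
  - by move=> r1 r2; rewrite modpD coefD.
  - by rewrite mod0p coef0.
have [i0 hi0] : exists i, v 0 i != 0 by apply/rV0Pn.
have [i1 hi1 hmax] := @arg_maxnP _ i0 (fun i => v 0 i != 0) (fun i => i : nat) hi0.
have hgq m i : trace (q^`() ^+ i * g ^+ (i + m)) = trace (g ^+ m).
  elim: i => [|i IH]; first by rewrite mul1r.
  rewrite -IH; apply: (@trace_eq_mod _ _ (- a * q^`() ^+ i * g ^+ (i + m))).
  have e2 : g * q^`() = 1 - a * q by rewrite -bezout; ring.
  transitivity (g * q^`() * q^`() ^+ i * g ^+ (i + m)); last by rewrite e2; ring.
  by rewrite exprS addSn exprS; ring.
have : trace (p * g ^+ i1) = 0.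
  by have /dvdpP[s ->] := hp; rewrite mulrAC trace_mull.
rewrite /p mulr_suml (big_morph trace traceD trace0) (bigD1 i1) //= big1 => [|i ni].
  rewrite addr0 -mulrA traceC -[X in g ^+ X]addn0 hgq expr0 trace1 // => /eqP.
  by rewrite mulf_eq0 (negPf hi1) (negPf (char0 _)).
have [e|nz] := eqVneq (v 0 i) 0; first by rewrite e polyC0 !mul0r trace0.
have /= hle := hmax i nz; have hlt : (i < i1)%N.
  by rewrite ltn_neqAle andbC; apply/andP; split.
rewrite -mulrA traceC; have -> : (i1 : nat) = (i + (i1 - i).-1.+1)%N by lia.
by rewrite hgq trace_inverseX mulr0.
Qed.

End Trace.

Lemma stable_riccati (q : {poly K}) : (1 < size q)%N -> q %| Delta q ->
  exists r, d r = W - r ^+ 2.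
Proof.
move: {2}(size q).+1 (ltnSn (size q)) => n; elim: n q => // n IH q hn s1 hq.
have q0 : q != 0 by rewrite -size_poly_gt0; lia.
have [/dvdpP[h hh]] := hq.
have [cop|ncop] := boolP (coprimep q q^`()); last first.
  apply: (IH (gcdp q q^`())).
  - have dq0 : q^`() != 0.
      apply/negP => /eqP e; have /eqP := congr1 (fun p : {poly K} => p`_(size q).-2) e.
      rewrite coef_deriv coef0; have -> : (size q).-2.+1 = (size q).-1 by lia.
      rewrite -lead_coefE -mulr_natr mulf_eq0 lead_coef_eq0 (negPf q0) /=.
      have -> : (size q).-1 = (size q).-2.+1 by lia.
      by rewrite (negPf (char0 _)).
    have h1 : (size (gcdp q q^`()) <= size q^`())%N by apply: leq_gcdpr.
    by apply: leq_ltn_trans h1 _; apply: leq_trans (lt_size_deriv q0) _; rewrite -ltnS.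
  - rewrite /coprimep in ncop; have := gcdp_eq0 q q^`(); rewrite (negPf q0) /= => g0.
    have : size (gcdp q q^`()) != 0 by rewrite size_poly_eq0 g0.
    by case: (size _) ncop => [|[|k]].
  - have [u hu] := Bezoutp q q^`(); set g := gcdp _ _ in hu *.
    have gq : g %| q := dvdp_gcdl _ _; have gq' : g %| q^`() := dvdp_gcdr _ _.
    have gDq : g %| Delta q := dvdp_trans gq hq.
    have gDq' : g %| Delta q^`().
      have -> : Delta q^`() = h^`() * q + h * q^`() - (W%:P - 'X^2)^`() * q^`().
        by have := deriv_dext hd (W%:P - 'X^2) q; rewrite hh derivM => ->; ring.
      by rewrite dvdp_sub ?dvdp_add ?dvdp_mull.
    have [[c1 c2] /andP[/= c10 c20] ec] := eqpP _ _ hu.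
    have eg : g = (c2^-1 * c1)%:P * (u.1 * q + u.2 * q^`()).
      by rewrite mul_polyC -scalerA ec scalerA mulVf // scale1r.
    rewrite {2}eg hD.2 hD.1 !hD.2 dextC //.
    by rewrite !dvdp_add // ?dvdp_mull // ?dvdp_add // ?dvdp_mull.
have lq : lead_coef q != 0 by rewrite lead_coef_eq0.
pose q1 := (lead_coef q)^-1 *: q.
have mq : q1 \is monic by rewrite monicE lead_coefZ mulVf.
have sq : size q1 = size q by rewrite size_scale // invr_eq0.
have stq : q1 %| Delta q1.
  rewrite dvdpZl ?invr_eq0 // /q1 -mul_polyC hD.2.
  by rewrite dvdp_add // dvdp_mull.
have cq : coprimep q1 q1^`() by rewrite derivZ coprimepZl ?coprimepZr ?invr_eq0.
case e: (size q) s1 => [//|[//|[|n']]] _; last first.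
  have [[a g] hag] := Bezout_eq1_coprimepP _ _ cq.
  by case: (@no_squarefree_stable n' q1 mq _ cq stq a g) => //; rewrite sq.
have [h1 hh1] := dvdpP _ _ stq.
have q11 : q1`_1 = 1 by rewrite -(monicP mq) lead_coefE sq e.
have eq1 : q1 = 'X + (q1`_0)%:P.
  apply/polyP => -[|[|i]]; rewrite coefD coefX coefC /= ?add0r ?addr0 // nth_default //.
  by rewrite sq e.
move: eq1; set b := q1`_0 => eq1; exists (- b).
have := congr1 (fun p : {poly K} => p.[- b]) hh1.
rewrite eq1 hD.1 dextX // dextC // hornerM !hornerE addNr mulr0 => /eqP.
by rewrite addrC addr_eq0 (derivationN hd) => /eqP ->; rewrite opprK.
Qed.
End Stable.

(** * Transcendence of exponentials and primitives *)

Section Subfields.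
Variables (L : fieldType) (D : L -> L).
Hypothesis hD : derivation D.

Lemma derivation_frac p q : q != 0 -> D (p / q) = (D p * q - p * D q) / q ^+ 2.
Proof.
move=> q0; have e2 : D (p / q) * q = D p - p / q * D q.
  by have := hD.2 (p / q) q; rewrite divfK // => ->; ring.
apply: (mulIf q0); rewrite e2; field.
by rewrite q0.
Qed.

Lemma fractions_subfield (R : comNzRingType) (e : {rmorphism R -> L}) :
  subfield_pred (fun z => exists p q, e q != 0 /\ z = e p / e q).
Proof.
split=> [a b [p [q [q0 ->]]] [r [s [s0 ->]]]|]; last split.
- exists (p * s - r * q), (q * s); rewrite rmorphB !rmorphM mulf_neq0 //; split=> //; field.
  by rewrite q0 s0.
- move=> a b [p [q [q0 ->]]] [r [s [s0 ->]]]; exists (p * r), (q * s).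
  by rewrite !rmorphM mulf_neq0 //; split=> //; field; rewrite q0 s0.
- move=> a [p [q [q0 ->]]]; have [p0|p0] := eqVneq (e p) 0.
    by exists 0, 1; rewrite rmorph0 rmorph1 oner_neq0 p0 !mul0r invr0.
  by exists q, p; split=> //; rewrite invf_div.
Qed.

Lemma differential_fraction_field (R : comNzRingType) (e : {rmorphism R -> L}) :
  (forall a, exists b, D (e a) = e b) ->
  exists (k : fieldType) (j : {rmorphism k -> L}) (d : k -> k),
    [/\ derivation d, forall a, D (j a) = j (d a) &
        forall z, (exists a, z = j a) <-> exists p q, e q != 0 /\ z = e p / e q].
Proof.
move=> hDe.
have S1 : exists p q, e q != 0 /\ 1 = e p / e q.
  by exists 1, 1; rewrite rmorph1 oner_neq0 divr1.
have [k [j hj]] := subfield_type (fractions_subfield e) S1.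
have hd (a : k) : exists b, D (j a) = j b.
  have [p [q [q0 ->]]] := (hj (j a)).2 (ex_intro _ a erefl).
  apply/hj; rewrite derivation_frac //.
  have [p' hp] := hDe p; have [q' hq] := hDe q.
  exists (p' * q - p * q'), (q ^+ 2).
  by rewrite rmorphXn expf_neq0 // rmorphB !rmorphM hp hq.
have [d hd'] := choice hd; exists k, j, d; split=> //; last by move=> z; split=> /hj.
by split=> a b; apply: (fmorph_inj j); rewrite -hd' !(rmorphD, rmorphM) ?hD.1 ?hD.2 !hd'.
Qed.

End Subfields.

Lemma rmorphism_lift (R k L : comNzRingType) (f : {rmorphism R -> L}) (j : {rmorphism k -> L}) :
  injective j -> (forall a, exists b, f a = j b) ->
  exists e : {rmorphism R -> k}, forall a, f a = j (e a).
Proof.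
move=> j_inj /choice[phi hphi].
have hB : zmod_morphism phi by move=> a b; apply: j_inj; rewrite rmorphB -!hphi rmorphB.
have hM : monoid_morphism phi.
  by split=> [|a b]; apply: j_inj; rewrite ?rmorphM -!hphi ?rmorphM // !rmorph1.
pose e : {rmorphism R -> k} :=
  HB.pack phi (GRing.isZmodMorphism.Build _ _ phi hB) (GRing.isMonoidMorphism.Build _ _ phi hM).
by exists e.
Qed.

Lemma evp_comp (R k : comNzRingType) (L : fieldType) (e : {rmorphism R -> k})
    (f : {rmorphism R -> L}) (j : {rmorphism k -> L}) v :
  (forall a, f a = j (e a)) -> forall p, evp f v p = evp j v (map_poly e p).
Proof.
by move=> h p; rewrite !evpE; congr (_.[v]); apply/polyP => i; rewrite !coef_map /= h.
Qed.

Lemma evp_lift (R k : comNzRingType) (L : fieldType) (f : {rmorphism R -> L})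
    (j : {rmorphism k -> L}) v : injective j -> (forall a, exists b, f a = j b) ->
  injective f -> injective (evp j v) -> injective (evp f v).
Proof.
move=> j_inj hfj f_inj ev_inj p q.
have [e he] := rmorphism_lift j_inj hfj.
rewrite !(evp_comp _ he) => /ev_inj/polyP h; apply/polyP => i.
by apply: f_inj; rewrite !he; have := h i; rewrite !coef_map => ->.
Qed.

Lemma coprime_quotient (k L : fieldType) (e : {rmorphism {poly k} -> L}) (p q : {poly k}) :
  injective e -> e q != 0 ->
  exists p1 q1 : {poly k}, [/\ coprimep p1 q1, q1 \is monic, e q1 != 0 &
    e p / e q = e p1 / e q1].
Proof.
move=> inj q0.
have q0' : q != 0 by apply: contraNneq q0 => ->; rewrite rmorph0.
have g0 : gcdp p q != 0 by rewrite gcdp_eq0 negb_and q0' orbT.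
set g := gcdp p q in g0.
have /dvdpP[p1 ep] : g %| p := dvdp_gcdl _ _.
have /dvdpP[q1 eq] : g %| q := dvdp_gcdr _ _.
have q10 : q1 != 0 by apply: contraNneq q0'; rewrite eq => ->; rewrite mul0r.
have cop : coprimep p1 q1.
  have [u hu] := Bezoutp p q; apply/Bezout_coprimepP; exists u.
  by move: hu; rewrite -/g {1}ep {1}eq !mulrA -mulrDl -{2}[g]mul1r eqp_mul2r.
pose l := lead_coef q1; have l0 : l != 0 by rewrite lead_coef_eq0.
have e0 r : r != 0 -> e r != 0.
  by move=> r0; rewrite -(rmorph0 e) (inj_eq inj).
exists (l^-1 *: p1), (l^-1 *: q1); split.
- by rewrite coprimepZl ?coprimepZr ?invr_eq0.
- by rewrite monicE lead_coefZ mulVf.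
- by rewrite e0 // scaler_eq0 invr_eq0 negb_or l0.
- have el : e (l^-1)%:P != 0 by rewrite e0 // polyC_eq0 invr_eq0.
  rewrite ep eq -!mul_polyC !rmorphM; move: el (e0 _ q10) (e0 _ g0).
  by move: (e (_)%:P) (e q1) (e g) (e p1) => a b c r a0 b0 c0; field; rewrite a0 b0 c0.
Qed.

Lemma coprime_fraction (k L : fieldType) (j : {rmorphism k -> L}) v (p q : {poly k}) :
  injective (evp j v) -> evp j v q != 0 ->
  exists p1 q1 : {poly k}, [/\ coprimep p1 q1, q1 \is monic, evp j v q1 != 0 &
    evp j v p / evp j v q = evp j v p1 / evp j v q1].
Proof. exact: (@coprime_quotient _ _ (evp j v)). Qed.

Section ExponentialAndPrimitive.
Variables (k L : fieldType) (j : {rmorphism k -> L}) (d : k -> k) (D : L -> L).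
Hypotheses (hd : derivation d) (hD : derivation D) (hj : forall a, D (j a) = j (d a)).
Variables (u : k) (y : L).
Hypotheses (y0 : y != 0) (hy : D y = j u * y).
Hypothesis no_exp : forall m a, a != 0 -> d a != m.+1%:R * u * a.
Local Notation Du := (dext d (u%:P * 'X)).

Let hDu : derivation Du := dext_derivation hd _.

Lemma coef_dext_exp p i : (Du p)`_i = d p`_i + u * (p`_i *+ i).
Proof. by rewrite coef_dext // -mulrA coefCM; case: i => [|i]; rewrite coefXM // coef_deriv. Qed.

Lemma stable_exponential P : P \is monic -> P`_0 != 0 -> P %| Du P -> size P = 1%N.
Proof.
move=> mP P0 hP; have Pn0 : P != 0 by rewrite monic_neq0.
pose m := (size P).-1; have sP : size P = m.+1 by rewrite /m prednK // size_poly_gt0.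
case em : m => [|m']; first by rewrite sP em.
have e : Du P = (m%:R * u)%:P * P.
  apply/eqP; rewrite -subr_eq0; apply/eqP; apply: (@dvdp_small0 _ _ P).
    rewrite sP; apply/leq_sizeP => i hi; rewrite coefB coef_dext_exp coefCM.
    have [hi'|hi'] := leqP (size P) i.
      by rewrite nth_default // (derivation0 hd) mul0rn !mulr0 addr0 subr0.
    have -> : i = m by lia.
    have -> : P`_m = 1 by rewrite /m -lead_coefE (monicP mP).
    by rewrite (derivation1 hd) mulr1 add0r -[X in X - _]mulrC subrr.
  by rewrite dvdp_sub // dvdp_mull.
have := congr1 (fun p : {poly k} => p`_0) e; rewrite coef_dext_exp coefCM mulr0n mulr0 addr0.
by move/eqP; rewrite em (negPf (no_exp _ P0)).
Qed.

Lemma D_evp_exp p : D (evp j y p) = evp j y (Du p).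
Proof. by apply: evp_dext => //; rewrite evpM evpC evpX. Qed.

Lemma exponential_transcendental : injective (evp j y).
Proof.
apply: evp_inj => P mP sP zP minP.
have : P %| Du P by apply: minP; rewrite -D_evp_exp zP derivation0.
have P0 : P`_0 != 0.
  apply: contraTneq sP => P0; rewrite -leqNgt.
  have [s hs] : exists s, P = s * 'X.
    by apply/dvdpP; rewrite -['X]subr0 -polyC0 dvdp_XsubCl /root horner_coef0 P0.
  have s0 : s != 0 by apply: contraTneq mP; rewrite hs => ->; rewrite mul0r monicE lead_coef0 eq_sym oner_eq0.
  have := zP; rewrite hs evpM evpX => /eqP; rewrite mulf_eq0 (negPf y0) orbF => /eqP /minP.
  by move/(dvdp_leq s0); rewrite hs size_mulX // ltnn.
by move/(stable_exponential mP P0) => s1; rewrite s1 in sP.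
Qed.

Hypothesis char0 : forall n, n.+1%:R != 0 :> k.
Variables (w : k) (t : L).
Hypotheses (w0 : w != 0) (ht : D t = j w / y ^+ 2).
Hypothesis no_prim : forall f, d f != 2%:R * u * f + w.

Lemma no_primitive_fraction (N M : {poly k}) : coprimep N M -> M \is monic ->
  'X^2 * (Du N * M - N * Du M) = w%:P * M ^+ 2 -> False.
Proof.
move=> cop mM; have M0 := monic_neq0 mM.
have [e [M1]] := multiplicity_XsubC M 0; rewrite M0 /= subr0 => rM1 eM h.
have mM1 : M1 \is monic by have := mM; rewrite eM monicMr // monicXn.
have copX : coprimep M1 'X by rewrite coprimepX.
have copN : coprimep M1 N.
  by move: cop; rewrite coprimep_sym eM coprimepMl => /andP[].
have stM1 : M1 %| Du M1.
  have : M1 %| 'X^2 * (N * Du M).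
    have -> : 'X^2 * (N * Du M) = ('X^2 * Du N - w%:P * M) * M.
      by rewrite mulrBl -[w%:P * M * M]mulrA -expr2 -h; ring.
    by rewrite dvdp_mull // eM dvdp_mulr.
  rewrite Gauss_dvdpr ?coprimep_expr // Gauss_dvdpr // eM hDu.2.
  rewrite dvdp_addl; last exact: dvdp_mulr.
  by rewrite Gauss_dvdpl // coprimep_expr.
have M11 : M1 = 1.
  have := stable_exponential mM1 _ stM1; rewrite -horner_coef0 => /(_ rM1) s1.
  by have := monicP mM1; rewrite lead_coefE s1 /= => c1; rewrite (size1_polyC (eq_leq s1)) c1.
rewrite M11 mul1r in eM.
have DX : Du 'X^e = e%:R * u%:P * 'X^e.
  by apply: derivation_eigenX => //; rewrite dextX.
have {}h : 'X^2 * (Du N - (e%:R * u)%:P * N) = w%:P * 'X^e.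
  apply: (mulfI M0); rewrite eM; move: h; rewrite eM DX polyCM polyC_natr => h.
  transitivity ('X^2 * (Du N * 'X^e - N * (e%:R * u%:P * 'X^e))); first by ring.
  by rewrite h; ring.
have := congr1 (fun p : {poly k} => p`_e) h; rewrite coefXnM coefCM coefXn eqxx mulr1.
case: ltnP => [_ /esym/eqP|he]; first by rewrite (negPf w0).
rewrite coefB coef_dext_exp coefCM => h2.
have := no_prim N`_(e - 2); rewrite -h2 => /eqP; apply.
have -> : e%:R = (e - 2)%:R + 2%:R :> k by rewrite -natrD subnK.
rewrite -mulr_natr; ring.
Qed.

Lemma primitive_transcendental : injective (evp (evp j y) t).
Proof.
have y_inj := exponential_transcendental.
have hDe p : exists q, D (evp j y p) = evp j y q by exists (Du p); exact: D_evp_exp.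
have [k2 [j2 [d2 [hd2 hj2 hk2]]]] := differential_fraction_field hD hDe.
apply: (@evp_lift _ _ _ _ j2) => // [|a|]; first exact: fmorph_inj.
  by apply/hk2; exists a, 1; rewrite rmorph1 oner_neq0 divr1.
have [v hv] : exists v, j w / y ^+ 2 = j2 v.
  apply/hk2; exists w%:P, 'X^2; rewrite rmorphXn.
  by rewrite [X in X ^+ _](evpX j y) [X in _ = X / _](evpC j y w) expf_neq0.
have char02 n : n.+1%:R != 0 :> k2.
  by rewrite -(fmorph_eq0 j2) rmorph_nat -(rmorph_nat j) fmorph_eq0.
apply: evp_inj => P mP sP zP minP.
have hP : P %| dext d2 v%:P P.
  apply: minP; rewrite -(@evp_dext _ _ _ _ _ D) // ?zP ?(derivation0 hD) //.
  by rewrite evpC -hv.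
have {}hP : dext d2 v%:P P = 0.
  apply: (dvdp_small0 _ hP); rewrite /dext.
  have P0 := monic_neq0 mP.
  apply: leq_ltn_trans (size_polyD _ _) _; rewrite gtn_max; apply/andP; split.
    by apply: leq_ltn_trans (size_map_der hd2 mP) _; case: (size P) sP.
  by rewrite mul_polyC; apply: leq_ltn_trans (size_scale_leq _ _) (lt_size_deriv P0).
pose m := (size P).-2.
have := congr1 (fun p : {poly k2} => p`_m) hP; rewrite coef_dext // coefCM coef_deriv coef0.
have -> : P`_m.+1 = 1.
  have -> : m.+1 = (size P).-1 by rewrite /m; case: (size P) sP => [|[]].
  by rewrite -lead_coefE (monicP mP).
move=> hm; pose g := - P`_m / m.+1%:R.
have hg : d2 g = v.
  have : d2 (m.+1%:R * g) = v *+ m.+1.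
    rewrite /g mulrC divfK // (derivationN hd2).
    by move/eqP: hm; rewrite addrC addr_eq0 mulr_natr => /eqP.
  by rewrite hd2.2 (derivation_nat hd2) mul0r add0r -[RHS]mulr_natl => /(mulfI (char02 m)).
have [N0 [M0 [M00 eg]]] := (hk2 (j2 g)).1 (ex_intro _ g erefl).
have [N [M [cop mM eM0 eNM]]] := coprime_fraction N0 y_inj M00.
rewrite eNM in eg; apply: (no_primitive_fraction cop mM); apply: y_inj.
have := hj2 g; rewrite hg -hv eg derivation_frac // !D_evp_exp => h.
rewrite !(evpM, evpB) !evpC !evpX.
have -> : j w = (evp j y (Du N) * evp j y M - evp j y N * evp j y (Du M)) / evp j y M ^+ 2 * y ^+ 2.
  by rewrite h; field.
by field.
Qed.

End ExponentialAndPrimitive.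

Lemma fraction_morphism (A : comNzRingType) (L : fieldType) (e1 e2 : {rmorphism A -> L}) :
  injective e1 -> injective e2 ->
  (forall z, exists p q, e1 q != 0 /\ z = e1 p / e1 q) ->
  exists s : {rmorphism L -> L}, forall p, s (e1 p) = e2 p.
Proof.
move=> inj1 inj2 h.
have /choice[pq hpq] (z : L) : exists pq : A * A, e1 pq.2 != 0 /\ z = e1 pq.1 / e1 pq.2.
  by have [p [q hz]] := h z; exists (p, q).
pose s z := e2 (pq z).1 / e2 (pq z).2.
have nz q : e1 q != 0 -> e2 q != 0.
  by apply: contraNneq => e; have := inj2 q 0; rewrite rmorph0 => /(_ e) ->; rewrite rmorph0.
have sE p q : e1 q != 0 -> s (e1 p / e1 q) = e2 p / e2 q.
  move=> q0; rewrite /s; have [r0] := hpq (e1 p / e1 q).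
  move: (pq _) r0 => [a b] /= b0 /eqP; rewrite eqr_div // -!rmorphM => /eqP /inj1 e.
  by apply/eqP; rewrite eqr_div ?nz // -!rmorphM e.
have hB : zmod_morphism s.
  move=> a b; have [q10 ->] := hpq a; have [q20 ->] := hpq b.
  move: (pq a) (pq b) q10 q20 => [p1 q1] [p2 q2] /= q10 q20.
  have -> : e1 p1 / e1 q1 - e1 p2 / e1 q2 = e1 (p1 * q2 - p2 * q1) / e1 (q1 * q2).
    by rewrite rmorphB !rmorphM; field; rewrite q10 q20.
  rewrite !sE ?rmorphM ?mulf_neq0 // rmorphB !rmorphM; field.
  by rewrite !nz.
have hM : monoid_morphism s.
  split=> [|a b].
    have -> : 1 = e1 1 / e1 1 by rewrite rmorph1 divr1.
    by rewrite sE ?rmorph1 ?oner_neq0 // divr1.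
  have [q10 ->] := hpq a; have [q20 ->] := hpq b.
  move: (pq a) (pq b) q10 q20 => [p1 q1] [p2 q2] /= q10 q20.
  have -> : e1 p1 / e1 q1 * (e1 p2 / e1 q2) = e1 (p1 * p2) / e1 (q1 * q2).
    by rewrite !rmorphM; field; rewrite q10 q20.
  rewrite !sE ?rmorphM ?mulf_neq0 //; field.
  by rewrite !nz.
pose S : {rmorphism L -> L} :=
  HB.pack s (GRing.isZmodMorphism.Build _ _ s hB) (GRing.isMonoidMorphism.Build _ _ s hM).
exists S => p; have -> : e1 p = e1 p / e1 1 by rewrite rmorph1 divr1.
by rewrite /= sE ?rmorph1 ?oner_neq0 // divr1.
Qed.

Lemma fraction_isomorphism (A : comNzRingType) (L : fieldType) (e1 e2 : {rmorphism A -> L}) :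
  injective e1 -> injective e2 ->
  (forall z, exists p q, e1 q != 0 /\ z = e1 p / e1 q) ->
  (forall z, exists p q, e2 q != 0 /\ z = e2 p / e2 q) ->
  exists s : {rmorphism L -> L}, bijective s /\ forall p, s (e1 p) = e2 p.
Proof.
move=> inj1 inj2 h1 h2.
have [s hs] := fraction_morphism inj1 inj2 h1.
have [t ht] := fraction_morphism inj2 inj1 h2.
exists s; split=> //; exists t => z.
  by have [p [q [_ ->]]] := h1 z; rewrite !fmorph_div /= !hs !ht.
by have [p [q [_ ->]]] := h2 z; rewrite !fmorph_div /= !ht !hs.
Qed.

Section RiccatiTower.
Variables (K L : fieldType) (j : {rmorphism K -> L}) (d : K -> K) (D : L -> L).
Hypotheses (hd : derivation d) (hD : derivation D) (hj : forall a, D (j a) = j (d a)).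
Hypothesis char0 : forall n, n.+1%:R != 0 :> K.
Variables (W w : K).
Hypotheses (w0 : w != 0) (dw : d w = 0).
Local Notation Delta := (dext d (W%:P - 'X^2)).

Section NoStable.
Variables (u y t : L).
Hypotheses (hu : D u = j W - u ^+ 2) (y0 : y != 0) (hy : D y = u * y).
Hypothesis ht : D t = j w / y ^+ 2.
Hypothesis no_stable : forall q : {poly K}, q %| Delta q -> q != 0 -> size q = 1%N.

Let hDelta : derivation Delta := dext_derivation hd _.

Lemma D_evp_riccati p : D (evp j u p) = evp j u (Delta p).
Proof. by apply: evp_dext => //; rewrite hu evpB evpC !expr2 evpM evpX. Qed.

Lemma riccati_transcendental : injective (evp j u).
Proof.
apply: evp_inj => P mP sP zP minP.
have := no_stable _ (monic_neq0 mP); rewrite (minP (Delta P)); last first.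
  by rewrite -D_evp_riccati zP derivation0.
by move/(_ isT) => e; rewrite e in sP.
Qed.

Lemma riccati_tower_injective : injective (evp (evp (evp j u) y) t).
Proof.
have u_inj := riccati_transcendental.
have hDe p : exists q, D (evp j u p) = evp j u q by exists (Delta p); exact: D_evp_riccati.
have [k [j1 [d1 [hd1 hj1 hk]]]] := differential_fraction_field hD hDe.
have j1_inj : injective j1 := @fmorph_inj _ _ j1.
have lift1 a : exists b, evp j u a = j1 b.
  by apply/hk; exists a, 1; rewrite rmorph1 oner_neq0 divr1.
have [e1 he1] := rmorphism_lift j1_inj lift1.
pose u1 := e1 'X; pose w1 := e1 w%:P.
have hu1 : j1 u1 = u by rewrite -he1; exact: evpX.
have hw1 : j1 w1 = j w by rewrite -he1; exact: evpC.
have char01 n : n.+1%:R != 0 :> k.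
  by rewrite -(fmorph_eq0 j1) rmorph_nat -(rmorph_nat j) fmorph_eq0.
have w10 : w1 != 0 by rewrite -(fmorph_eq0 j1) hw1 fmorph_eq0.
have fracE a : exists p q : {poly K}, [/\ coprimep p q, q \is monic,
    evp j u q != 0, j1 a = evp j u p / evp j u q &
    j1 (d1 a) = evp j u (Delta p * q - p * Delta q) / evp j u q ^+ 2].
  have [p0 [q0 [q00 ea]]] := (hk (j1 a)).1 (ex_intro _ a erefl).
  have [p [q [cop mq eq0 epq]]] := coprime_fraction p0 u_inj q00.
  exists p, q; split=> //; first by rewrite ea epq.
  by rewrite -hj1 ea epq derivation_frac // !D_evp_riccati evpB !evpM.
have no_exp m a : a != 0 -> d1 a != m.+1%:R * u1 * a.
  move=> a0; apply/eqP => h.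
  have [p [q [cop mq eq0 ea eda]]] := fracE a.
  have q0 := monic_neq0 mq.
  have p0 : p != 0.
    by apply: contraNneq a0 => p0; rewrite -(fmorph_eq0 j1) ea p0 evp0 mul0r.
  have {}h : Delta p * q - p * Delta q = m.+1%:R * 'X * p * q.
    apply: u_inj; apply: (mulIf (_ : (evp j u q ^+ 2)^-1 != 0)).
      by rewrite invr_eq0 expf_neq0.
    rewrite -eda h !(rmorphM j1) hu1 ea !evpM evpX (rmorph_nat j1) (rmorph_nat (evp j u)).
    by field.
  have sp : size p = 1%N.
    apply: no_stable p0; rewrite -(Gauss_dvdpl _ cop).
    have -> : Delta p * q = p * (Delta q + m.+1%:R * 'X * q).
      by rewrite mulrDr -[_ + p * _]addrC -[Delta p * q](subrK (p * Delta q)) h; ring.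
    exact: dvdp_mulr.
  have sq : size q = 1%N.
    apply: no_stable q0; rewrite coprimep_sym in cop; rewrite -(Gauss_dvdpr _ cop).
    have -> : p * Delta q = (Delta p - m.+1%:R * 'X * p) * q.
      by rewrite mulrBl -h; ring.
    exact: dvdp_mull.
  move: h p0 q0; rewrite (size1_polyC (eq_leq sp)) (size1_polyC (eq_leq sq)) !polyC_eq0.
  move: (p`_0) (q`_0) => a1 b1; rewrite !dextC // => h a10 b10.
  have := congr1 (fun r : {poly K} => r`_1) h.
  rewrite -!mulrA -polyC_natr coefCM coefXM -!polyCM -polyCB !coefC /= => /esym/eqP.
  by rewrite !mulf_eq0 (negPf a10) (negPf b10) (negPf (char0 m)).
have no_prim f : d1 f != 2%:R * u1 * f + w1.
  apply/eqP => h; have [p [q [cop mq eq0 ea eda]]] := fracE f.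
  have q0 := monic_neq0 mq.
  have {}h : Delta p * q - p * Delta q = 2%:R * 'X * p * q + w%:P * q ^+ 2.
    apply: u_inj; apply: (mulIf (_ : (evp j u q ^+ 2)^-1 != 0)).
      by rewrite invr_eq0 expf_neq0.
    rewrite -eda h (rmorphD j1) !(rmorphM j1) hu1 hw1 ea evpD !evpM evpX evpC (rmorph_nat j1).
    by rewrite (rmorph_nat (evp j u)); field.
  have sq : size q = 1%N.
    apply: no_stable q0; rewrite coprimep_sym in cop; rewrite -(Gauss_dvdpr _ cop).
    have -> : p * Delta q = (Delta p - 2%:R * 'X * p - w%:P * q) * q.
      transitivity (Delta p * q - (Delta p * q - p * Delta q)); first by ring.
      by rewrite h; ring.
    exact: dvdp_mull.
  have q1 : q = 1.
    by have := monicP mq; rewrite lead_coefE sq /= => c1; rewrite (size1_polyC (eq_leq sq)) c1.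
  have {}h : Delta p = 2%:R * 'X * p + w%:P.
    by move: h; rewrite q1 (derivation1 hDelta) mulr0 subr0 expr1n !mulr1.
  have [p0|p0] := eqVneq p 0.
    by move: h; rewrite p0 (derivation0 hDelta) mulr0 add0r => /esym/eqP; rewrite polyC_eq0 (negPf w0).
  have := congr1 (fun r : {poly K} => r`_(size p).-1.+1) h.
  rewrite coef_dextS // coefD -mulrA -polyC_natr coefCM coefXMS coefC /= addr0.
  have s1 : (size p <= (size p).-1.+1)%N := leqSpred _.
  rewrite -lead_coefE (nth_default _ s1) (nth_default _ (leqW s1)).
  rewrite (derivation0 hd) mul0rn mulr0 !add0r => e3.
  have : lead_coef p * ((size p).-1.+2)%:R = 0.
    by rewrite -addn2 natrD mulrDr mulr_natr [X in _ + X]mulrC -e3 subrr.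
  by move/eqP; rewrite mulf_eq0 lead_coef_eq0 (negPf p0) (negPf (char0 _)).
have hy1 : D y = j1 u1 * y by rewrite hu1.
have ht1 : D t = j1 w1 / y ^+ 2 by rewrite hw1.
have P1 := exponential_transcendental hd1 hD hj1 y0 hy1 no_exp.
have P2 := primitive_transcendental hd1 hD hj1 y0 hy1 no_exp char01 w10 ht1 no_prim.
have y_inj := evp_lift j1_inj lift1 u_inj P1.
apply: (evp_lift P1 _ y_inj P2) => p.
by exists (map_poly e1 p); apply: evp_comp.
Qed.

End NoStable.

Section RationalRiccati.
Variables (u : K) (y t : L).
Hypotheses (hu : d u = W - u ^+ 2) (y0 : y != 0) (hy : D y = j u * y).
Hypothesis ht : D t = j w / y ^+ 2.
Hypothesis no_invariant : forall N (P : {poly K}), (0 < N)%N ->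
  Delta P + N%:R * 'X * P = 0 -> P = 0.

Let hDelta : derivation Delta := dext_derivation hd _.

Lemma rational_tower_injective : injective (evp (evp j y) t).
Proof.
have DX : Delta ('X - u%:P) = - ('X + u%:P) * ('X - u%:P).
  by rewrite (derivationB hDelta) dextX // dextC // hu polyCB polyC_exp; ring.
apply: (primitive_transcendental hd hD hj y0 hy _ char0 w0 ht) => [m a a0|f]; apply/eqP => h.
- have := @no_invariant m.+1 (a%:P * ('X - u%:P) ^+ m.+1) isT.
  rewrite hDelta.2 dextC // (derivation_eigenX _ hDelta DX) h => e.
  have /eqP : a%:P * ('X - u%:P) ^+ m.+1 = 0.
    by apply: e; rewrite !polyCM polyC_natr; ring.
  by rewrite mulf_eq0 polyC_eq0 (negPf a0) expf_eq0 polyXsubC_eq0.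
- have := @no_invariant 2 (('X - u%:P) * (f%:P * 'X - (f * u + w)%:P)) isT.
  rewrite hDelta.2 DX => e.
  have : f%:P * 'X - (f * u + w)%:P = 0.
    apply/eqP; have : ('X - u%:P) * (f%:P * 'X - (f * u + w)%:P) = 0.
      apply: e; rewrite (derivationB hDelta) hDelta.2 dextX // !dextC //.
      rewrite hd.1 dw hd.2 hu h addr0 !(polyCD, polyCN, polyCM, polyC_exp, polyC_natr).
      by ring.
    by move/eqP; rewrite mulf_eq0 polyXsubC_eq0.
  move=> e1; have := congr1 (fun p : {poly K} => p`_1) e1.
  rewrite coefB coefCM coefX coefC /= mulr1 subr0 coef0 => f0.
  move/eqP: e1; rewrite f0 polyC0 !mul0r !add0r oppr_eq0 polyC_eq0.
  by rewrite (negPf w0).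
Qed.

End RationalRiccati.
End RiccatiTower.

(** * Rational solutions of the Riccati equation *)

Lemma base_field (C : numFieldType) (L : fieldType) (iota : {rmorphism C -> L}) (D : L -> L) (x : L) :
  derivation D -> D x = 1 -> (forall c, D (iota c) = 0) ->
  exists (K : fieldType) (j : {rmorphism K -> L}) (d : K -> K) (e : {rmorphism {poly C} -> K}),
    [/\ derivation d, forall a, D (j a) = j (d a), forall p, j (e p) = evp iota x p,
        forall p, d (e p) = e p^`() & injective e] /\
    forall z, exists p q, q != 0 /\ z = e p / e q.
Proof.
move=> hD hx hc.
have d0 : derivation (fun _ : C => 0) by split=> a b; rewrite ?mulr0 ?mul0r addr0.
have m0 (p : {poly C}) : map_poly (fun=> 0) p = 0 :> {poly C}.
  by apply/polyP => i; rewrite coef_map_id0 // coef0.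
have hDe p : D (evp iota x p) = evp iota x p^`().
  have hx' : D x = evp iota x 1 by rewrite hx rmorph1.
  have hc' a : D (iota a) = iota ((fun=> 0) a) by rewrite hc rmorph0.
  by rewrite (evp_dext d0 hD hc' hx') /dext m0 add0r mul1r.
have x_inj : injective (evp iota x).
  apply: evp_inj => P mP sP zP minP.
  have P'0 : P^`() = 0.
    apply: (dvdp_small0 (lt_size_deriv (monic_neq0 mP))).
    by apply: minP; rewrite -hDe zP derivation0.
  have := coef_deriv P (size P).-2; rewrite P'0 coef0.
  have -> : (size P).-2.+1 = (size P).-1 by case: (size P) sP => [|[]].
  rewrite -lead_coefE (monicP mP) => /esym/eqP; rewrite pnatr_eq0 => /eqP.
  by case: (size P) sP => [|[]].
have [K [j [d [hd hj hK]]]] :=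
  differential_fraction_field hD (fun p => ex_intro _ p^`() (hDe p)).
have j_inj : injective j := @fmorph_inj _ _ j.
have [|e he] := rmorphism_lift (f := evp iota x) j_inj.
  by move=> a; apply/hK; exists a, 1; rewrite rmorph1 oner_neq0 divr1.
have e_inj : injective e by move=> p q h; apply: x_inj; rewrite !he h.
exists K, j, d, e; split; first split=> // p.
- by rewrite he.
- by apply: j_inj; rewrite -hj -!he hDe.
move=> z; have [p [q [q0 hz]]] := (hK (j z)).1 (ex_intro _ z erefl).
exists p, q; split; last by apply: j_inj; rewrite hz fmorph_div /= -!he.
by apply: contraNneq q0 => ->; rewrite rmorph0.
Qed.

Section PolynomialRiccati.
Variables (C : numFieldType) (W : {poly C}) (k : nat).
Hypotheses (mW : W \is monic) (sW : size W = k.+1) (k0 : (0 < k)%N).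

Definition riccati_poly (S P : {poly C}) :=
  P^`(2) + 2%:R * S * P^`() + (S^`() + S ^+ 2 - W) * P = 0.

Lemma riccati_poly_degree (S P : {poly C}) : P \is monic -> riccati_poly S P ->
  exists n, [/\ k = (2 * n)%N, size S = n.+1, lead_coef S ^+ 2 = 1, (size (W - S ^+ 2)%R <= n)%N &
    (W - S ^+ 2)`_n.-1 = (2%:R * (size P).-1%:R + n%:R) * lead_coef S].
Proof.
move=> mP hP; have P0 := monic_neq0 mP.
have [m sP] : exists m, size P = m.+1 by exists (size P).-1; rewrite prednK // size_poly_gt0.
pose B : {poly C} := W - S ^+ 2; rewrite -/B.
have eB : B * P = P^`(2) + 2%:R * S * P^`() + S^`() * P.
  by apply/eqP; rewrite -subr_eq0 -oppr_eq0 -[X in _ == X]hP; apply/eqP; rewrite /B; ring.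
have W0 : W != 0 := monic_neq0 mW.
have sP' : (size P^`() <= m)%N by rewrite -ltnS -sP lt_size_deriv.
have sP2 : (size P^`(2) <= m.-1)%N.
  apply/leq_sizeP => i hi; rewrite derivSn derivn1 !coef_deriv nth_default ?mul0rn // sP; lia.
have S0 : S != 0.
  apply: contraTneq sP2 => S0; have := congr1 (fun p : {poly C} => size p) eB.
  rewrite /B S0 expr0n subr0 mulr0 mul0r -polyC0 derivC polyC0 mul0r !addr0 size_mul // sW sP.
  by move=> <-; lia.
have [s sS] : exists s, size S = s.+1 by exists (size S).-1; rewrite prednK // size_poly_gt0.
have s2 : size (2%:R * S) = s.+1.
  by rewrite -polyC_natr mul_polyC size_scale ?pnatr_eq0.
have sS' : (size S^`() <= s)%N by rewrite -ltnS -sS lt_size_deriv.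
have sB : (size B <= s)%N.
  have [->|B0] := eqVneq B 0; first by rewrite size_poly0.
  have : (size (B * P)%R <= s + m)%N.
    rewrite eB; apply: leq_trans (size_polyD _ _) _; rewrite geq_max; apply/andP; split.
      apply: leq_trans (size_polyD _ _) _; rewrite geq_max; apply/andP; split; first by lia.
      apply: leq_trans (size_polyMleq _ _) _; rewrite s2; lia.
    apply: leq_trans (size_polyMleq _ _) _; rewrite sP; lia.
  by rewrite size_mul // sP addnS leq_add2r.
have eW : W = S ^+ 2 + B by rewrite /B addrC subrK.
have sS2 : size (S ^+ 2) = (s + s).+1 by rewrite expr2 size_mul // sS; lia.
have lt : (size B < size (S ^+ 2)%R)%N by rewrite sS2; lia.
have ks : k = (2 * s)%N by have := sW; rewrite eW size_polyDl // sS2; lia.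
have l2 : lead_coef S ^+ 2 = 1.
  by have := monicP mW; rewrite eW lead_coefDl // expr2 lead_coefM.
exists s; split=> //.
have tB : top_coef B s.-1 B`_s.-1.
  by split=> // i hi; rewrite nth_default //; apply: leq_trans sB _; lia.
have tP : top_coef P m 1.
  by split=> [i hi|]; [rewrite nth_default // sP|rewrite -(monicP mP) lead_coefE sP].
have tS' : top_coef S^`() s.-1 (lead_coef S *+ s).
  split=> [i hi|]; first by rewrite nth_default //; apply: leq_trans sS' _; lia.
  by rewrite coef_deriv prednK ?lead_coefE ?sS //; lia.
have tS : top_coef (2%:R * S) s (2%:R * lead_coef S).
  split=> [i hi|]; first by rewrite nth_default // s2.
  by rewrite -polyC_natr coefCM lead_coefE sS.
have [_ cB] := top_coefM tB tP; have [_ cS'] := top_coefM tS' tP.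
have cP2 : (P^`(2))`_(s.-1 + m) = 0 by rewrite nth_default //; apply: leq_trans sP2 _; lia.
have cSP : (2%:R * S * P^`())`_(s.-1 + m) = 2%:R * lead_coef S * m%:R.
  have [m0|mpos] := posnP m.
    have -> : P^`() = 0 by apply/eqP; rewrite -size_poly_eq0; move: sP'; rewrite m0 leqn0.
    by rewrite m0 !mulr0 coef0.
  have tP' : top_coef P^`() m.-1 m%:R.
    split=> [i hi|]; first by rewrite nth_default //; apply: leq_trans sP' _; lia.
    by rewrite coef_deriv prednK // tP.2.
  by have [_ <-] := top_coefM tS tP'; congr (_`_ _); lia.
move: cB; rewrite eB !coefD cP2 cSP cS' !mulr1 add0r => <-.
by rewrite sP -mulr_natr /=; ring.
Qed.

Lemma riccati_poly_cases (S P : {poly C}) :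
  P \is monic -> riccati_poly S P -> exists n (A B : {poly C}) m,
    k = (2 * n)%N /\ A \is monic /\ size A = n.+1 /\ (size B <= n)%N /\ W = A ^+ 2 + B /\
    size P = m.+1 /\
    ((S = A /\ B`_n.-1 - n%:R = (2 * m)%:R) \/ (S = - A /\ - B`_n.-1 - n%:R = (2 * m)%:R)).
Proof.
move=> mP hP; have [n [kn sS l2 sB cB]] := riccati_poly_degree mP hP.
have sP : size P = (size P).-1.+1 by rewrite prednK // size_poly_gt0 monic_neq0.
have : (lead_coef S == 1) || (lead_coef S == -1) by rewrite -eqf_sqr l2 expr1n.
case/orP => /eqP lS; rewrite lS ?mulr1 ?mulrN1 in cB.
- exists n, S, (W - S ^+ 2), (size P).-1; rewrite monicE lS eqxx subrKC cB.
  by do !split=> //; left; split=> //; rewrite natrM; ring.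
- exists n, (- S), (W - S ^+ 2), (size P).-1; rewrite monicE lead_coefN lS opprK eqxx size_polyN.
  rewrite sqrrN subrKC cB opprK; do !split=> //; right; split=> //; rewrite natrM; ring.
Qed.

End PolynomialRiccati.

Section RationalSolution.
Variables (C : numFieldType) (K : fieldType) (d : K -> K) (e : {rmorphism {poly C} -> K}).
Hypotheses (hd : derivation d) (de : forall p, d (e p) = e p^`()) (e_inj : injective e).
Hypothesis e_frac : forall z, exists p q, q != 0 /\ z = e p / e q.
Variable W : {poly C}.

Let e0 p : (e p == 0) = (p == 0).
Proof. by rewrite -(rmorph0 e) (inj_eq e_inj). Qed.

Lemma riccati_of_poly S P : P != 0 -> riccati_poly W S P ->
  d (e P^`() / e P + e S) = e W - (e P^`() / e P + e S) ^+ 2.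
Proof.
move=> P0 hP; have eP : e P != 0 by rewrite e0.
rewrite hd.1 derivation_frac // !de; apply/eqP; rewrite -subr_eq0; apply/eqP.
transitivity (e (P^`()^`() + 2%:R * S * P^`() + (S^`() + S ^+ 2 - W) * P) / e P).
  by rewrite !(rmorphD, rmorphM, rmorphN, rmorphXn, rmorph_nat) /=; field.
by rewrite -[P^`()^`()]/(P^`(2)) hP rmorph0 mul0r.
Qed.

Lemma poly_of_riccati z : d z = e W - z ^+ 2 ->
  exists S P, P \is monic /\ riccati_poly W S P.
Proof.
have [p0 [q0 [q00 ->]]] := e_frac z.
rewrite -e0 in q00; have [a [b [cop mb b0 ->]]] := coprime_quotient p0 e_inj q00.
rewrite derivation_frac // !de => h.
have h1 : a^`() * b - a * b^`() + a ^+ 2 = W * b ^+ 2.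
  apply: e_inj; rewrite !(rmorphD, rmorphM, rmorphN) /=.
  have -> : e a^`() * e b - e a * e b^`() =
     (e a^`() * e b - e a * e b^`()) / e b ^+ 2 * e b ^+ 2 by field.
  by rewrite h; field.
have : b %| a * (a - b^`()).
  have -> : a * (a - b^`()) = (W * b - a^`()) * b.
    transitivity ((a^`() * b - a * b^`() + a ^+ 2) - a^`() * b); first by ring.
    by rewrite h1; ring.
  exact: dvdp_mull.
rewrite Gauss_dvdpr 1?coprimep_sym // => /dvdpP[S hS].
exists S, b; split=> //; rewrite /riccati_poly.
have ea : a = b^`() + S * b by rewrite -hS addrC subrK.
apply: (mulIf (monic_neq0 mb)); rewrite mul0r.
transitivity (a^`() * b - a * b^`() + a ^+ 2 - W * b ^+ 2); last by rewrite h1 subrr.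
by rewrite ea derivD derivM -[b^`(2)]/(b^`()^`()); ring.
Qed.

End RationalSolution.

(** * The differential Galois group *)

Lemma det_mx2 (R : comNzRingType) (M : 'M[R]_2) :
  \det M = M ord0 ord0 * M ord_max ord_max - M ord0 ord_max * M ord_max ord0.
Proof.
rewrite (expand_det_row _ ord0) big_ord_recl big_ord1 /cofactor !det_mx11 !mxE /=.
have -> : lift ord0 (ord0 : 'I_1) = ord_max :> 'I_2 by apply: val_inj.
have -> : lift ord_max (ord0 : 'I_1) = ord0 :> 'I_2 by apply: val_inj.
by rewrite expr0 expr1; ring.
Qed.

Lemma ord2_ind (P : 'I_2 -> Prop) : P ord0 -> P ord_max -> forall i, P i.
Proof.
move=> h0 h1 [[|[|i]] hi] //; first by have -> : Ordinal hi = ord0 by apply: val_inj.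
by have -> : Ordinal hi = ord_max by apply: val_inj.
Qed.

Section PicardVessiot.
Variables (C : numClosedFieldType) (L : fieldType) (iota : {rmorphism C -> L}).
Variables (D : L -> L) (x W : L).

Definition pair_row (y1 y2 : L) : 'rV[L]_2 := \row_i (if i == ord0 then y1 else y2).

Lemma pair_rowM y1 y2 (M : 'M[C]_2) c : (pair_row y1 y2 *m map_mx iota M) 0 c =
  y1 * iota (M ord0 c) + y2 * iota (M ord_max c).
Proof.
rewrite mxE big_ord_recl big_ord1 !mxE /=.
by have -> : lift ord0 (ord0 : 'I_1) = ord_max :> 'I_2 by apply: val_inj.
Qed.

Lemma pair_row_eta (Z : 'rV[L]_2) : pair_row (Z 0 ord0) (Z 0 ord_max) = Z.
Proof. by apply/rowP; apply: ord2_ind; rewrite mxE. Qed.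

Definition differential_galois (s : {rmorphism L -> L}) :=
  bijective s /\ (forall z, s (D z) = D (s z)) /\ s x = x /\ (forall c, s (iota c) = iota c).

Lemma galmatP y1 y2 M : galmat iota D x y1 y2 M <->
  exists s : {rmorphism L -> L}, differential_galois s /\
    map_mx s (pair_row y1 y2) = pair_row y1 y2 *m map_mx iota M.
Proof.
split=> [[s [hb [hD [hx [hc [h1 h2]]]]]]|[s [[hb [hD [hx hc]]] h]]]; exists s.
  by split=> //; apply/rowP; apply: ord2_ind; rewrite pair_rowM !mxE.
have h1 := congr1 (fun Z : 'rV[L]_2 => Z 0 ord0) h.
have h2 := congr1 (fun Z : 'rV[L]_2 => Z 0 ord_max) h.
by rewrite !pair_rowM !mxE /= in h1 h2.
Qed.

Lemma galmat_conj y1 y2 z1 z2 (Q M : 'M[C]_2) : Q \in unitmx ->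
  pair_row z1 z2 = pair_row y1 y2 *m map_mx iota Q ->
  galmat iota D x y1 y2 M <-> galmat iota D x z1 z2 (invmx Q *m M *m Q).
Proof.
move=> uQ hz; have uQ' : map_mx iota Q \in unitmx by rewrite map_unitmx.
rewrite !galmatP; split=> -[s [hs h]]; exists s; split=> //.
all: have sQ : map_mx s (map_mx iota Q) = map_mx iota Q
  by apply/matrixP => i l; rewrite !mxE; case: hs => [_ [_ [_ ->]]].
  by rewrite hz map_mxM sQ h !map_mxM map_invmx !mulmxA mulmxK.
move: h; rewrite hz map_mxM sQ !map_mxM map_invmx !mulmxA mulmxK //.
by move/(congr1 (mulmx^~ (invmx (map_mx iota Q)))); rewrite !mulmxK.
Qed.

Definition wronskian (y1 y2 : L) := y1 * D y2 - D y1 * y2.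

Lemma wronskianM y1 y2 z1 z2 (Q : 'M[C]_2) : derivation D -> (forall c, D (iota c) = 0) ->
  pair_row z1 z2 = pair_row y1 y2 *m map_mx iota Q ->
  wronskian z1 z2 = wronskian y1 y2 * iota (\det Q).
Proof.
move=> hD hc hz.
have := congr1 (fun Z : 'rV[L]_2 => Z 0 ord0) hz.
have := congr1 (fun Z : 'rV[L]_2 => Z 0 ord_max) hz.
rewrite !pair_rowM !mxE /= => -> ->.
rewrite /wronskian !hD.1 !hD.2 !hc det_mx2 rmorphB !rmorphM; ring.
Qed.

Lemma PV_basis_change y1 y2 z1 z2 (Q : 'M[C]_2) : Q \in unitmx ->
  pair_row z1 z2 = pair_row y1 y2 *m map_mx iota Q ->
  PV_ext iota D x W y1 y2 -> PV_ext iota D x W z1 z2.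
Proof.
move=> uQ hz [hD [hx [hc [h1 [h2 [w0 [hconst hgen]]]]]]].
have uQ' : map_mx iota Q \in unitmx by rewrite map_unitmx.
have hy : pair_row y1 y2 = pair_row z1 z2 *m map_mx iota (invmx Q).
  by rewrite hz map_invmx mulmxK.
have hwr := wronskianM hD hc hz.
have z1E := congr1 (fun Z : 'rV[L]_2 => Z 0 ord0) hz.
have z2E := congr1 (fun Z : 'rV[L]_2 => Z 0 ord_max) hz.
have y1E := congr1 (fun Z : 'rV[L]_2 => Z 0 ord0) hy.
have y2E := congr1 (fun Z : 'rV[L]_2 => Z 0 ord_max) hy.
rewrite !pair_rowM !mxE /= in z1E z2E y1E y2E.
do ![split=> //].
- by rewrite z1E !(hD.1, hD.2, hc) h1 h2 ?mulr0 ?addr0 ?(derivation0 hD); ring.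
- by rewrite z2E !(hD.1, hD.2, hc) h1 h2 ?mulr0 ?addr0 ?(derivation0 hD); ring.
- rewrite -/(wronskian z1 z2) hwr mulf_neq0 // fmorph_eq0.
  by move: uQ; rewrite unitmxE unitfE.
- move=> S hS Sc Sx S1 S2 S1' S2'; have [hB [hM _]] := hS.
  have S0 : S 0 by rewrite -(rmorph0 iota).
  have hA a b : S a -> S b -> S (a + b).
    by move=> Sa Sb; rewrite -[b]opprK -[- b]sub0r; apply: (hB) => //; apply: (hB).
  apply: hgen => //; rewrite ?y1E ?y2E ?(hD.1, hD.2, hc) ?mulr0 ?addr0.
  all: by apply: hA; do ?[apply: (hM) => //]; rewrite ?addr0.
Qed.

End PicardVessiot.

Section GaloisExtension.
Variables (C : numClosedFieldType) (L : fieldType) (iota : {rmorphism C -> L}).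
Variables (D : L -> L) (x : L) (V : {poly C}).
Local Notation W := (evp iota x V).
Local Notation PV := (PV_ext iota D x W).
Local Notation wr := (wronskian D).
Local Notation galois := (differential_galois iota D x).

Lemma PV_nonzero y1 y2 : PV y1 y2 -> y1 != 0.
Proof.
move=> [hD [_ [_ [_ [_ [w0 _]]]]]]; apply: contraNneq w0 => ->.
by rewrite (derivation0 hD) !mul0r subrr.
Qed.

Lemma PV_wronskian y1 y2 : PV y1 y2 -> exists2 c, c != 0 & wr y1 y2 = iota c.
Proof.
move=> [hD [_ [_ [h1 [h2 [w0 [hconst _]]]]]]].
have [|c hc] := hconst (wr y1 y2).
  by rewrite /wronskian (derivationB hD) !hD.2 h1 h2; ring.
by exists c => //; rewrite -(fmorph_eq0 iota) -hc.
Qed.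

Lemma derivation_ratio y1 y2 : derivation D -> y1 != 0 -> D (y2 / y1) = wr y1 y2 / y1 ^+ 2.
Proof. by move=> hD y0; rewrite derivation_frac // /wronskian; congr (_ / _); ring. Qed.

Section Extension.
Variables (R : comNzRingType) (f g : {rmorphism R -> L}) (y1 y2 z1 z2 : L) (rx ru : R).
Hypotheses (hy : PV y1 y2) (hz : PV z1 z2) (hw : wr y1 y2 = wr z1 z2).
Hypotheses (hfc : forall c, exists r, f r = iota c /\ g r = iota c).
Hypotheses (fx : f rx = x) (gx : g rx = x).
Hypotheses (fu : D y1 = f ru * y1) (gu : D z1 = g ru * z1).

Lemma PV_fractions (h : {rmorphism R -> L}) u1 u2 : PV u1 u2 ->
  (forall c, exists r, h r = iota c) -> h rx = x -> D u1 = h ru * u1 ->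
  forall z, exists p q, evp (evp h u1) (u2 / u1) q != 0 /\
    z = evp (evp h u1) (u2 / u1) p / evp (evp h u1) (u2 / u1) q.
Proof.
move=> hu hc hx hru; have u10 := PV_nonzero hu; have [w w0 hw1] := PV_wronskian hu.
have [hD [_ [_ [_ [_ [_ [_ hgen]]]]]]] := hu.
set ev := evp (evp h u1) (u2 / u1).
have hS := fractions_subfield (ev : {rmorphism _ -> L}).
have Sev p z : ev p = z -> exists a b, ev b != 0 /\ z = ev a / ev b.
  by move=> <-; have ev1 : ev 1 = 1 := rmorph1 _; exists p, 1; rewrite ev1 oner_neq0 divr1.
have [hB [hM hV]] := hS.
have Sc c : exists p q, ev q != 0 /\ iota c = ev p / ev q.
  by have [r hr] := hc c; apply: (Sev (r%:P)%:P); rewrite /ev evpC /= evpC.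
have S1 : exists p q, ev q != 0 /\ u1 = ev p / ev q.
  by apply: (Sev ('X)%:P); rewrite /ev evpC /= evpX.
have S2 : exists p q, ev q != 0 /\ u2 = ev p / ev q.
  by apply: (Sev (('X)%:P * 'X)); rewrite /ev evpM evpC /= !evpX mulrC divfK.
have S1' : exists p q, ev q != 0 /\ D u1 = ev p / ev q.
  by apply: (Sev (ru%:P * 'X)%:P); rewrite /ev evpC /= evpM evpC evpX hru.
apply: hgen => //.
  by apply: (Sev (rx%:P)%:P); rewrite /ev evpC /= evpC hx.
have -> : D u2 = (iota w - (iota 0 - D u1 * u2)) * u1^-1.
  by rewrite -hw1 rmorph0 /wronskian; field.
by apply: (hM); [apply: (hB) => //; apply: (hB) => //; apply: (hM)|apply: (hV)].
Qed.

Lemma galois_extension :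
  injective (evp (evp f y1) (y2 / y1)) -> injective (evp (evp g z1) (z2 / z1)) ->
  exists s : {rmorphism L -> L}, galois s /\ s y1 = z1 /\ s y2 = z2.
Proof.
move=> inj1 inj2.
have fr1 := PV_fractions hy (fun c => let: ex_intro r h := hfc c in ex_intro _ r h.1) fx fu.
have fr2 := PV_fractions hz (fun c => let: ex_intro r h := hfc c in ex_intro _ r h.2) gx gu.
have [s [bs hs]] := fraction_isomorphism inj1 inj2 fr1 fr2.
have y10 := PV_nonzero hy; have z10 := PV_nonzero hz.
have sc c : s (iota c) = iota c.
  have [r [h1 h2]] := hfc c; have := hs ((r%:P)%:P).
  by rewrite /= !evpC /= !evpC h1 h2.
have sx : s x = x by have := hs ((rx%:P)%:P); rewrite /= !evpC /= !evpC fx gx.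
have s1 : s y1 = z1 by have := hs (('X)%:P); rewrite /= !evpC /= !evpX.
have s2 : s y2 = z2.
  have := hs (('X)%:P * 'X); rewrite /= !evpM !evpC /= !evpX.
  by rewrite mulrC divfK // mulrC divfK.
have s1' : s (D y1) = D z1.
  by have := hs ((ru%:P * 'X)%:P); rewrite /= !evpC /= !evpM !evpC !evpX fu gu.
have s2' : s (D y2) = D z2.
  have [w _ hw1] := PV_wronskian hy.
  have -> : D y2 = (iota w + D y1 * y2) / y1 by rewrite -hw1 /wronskian; field.
  rewrite fmorph_div rmorphD rmorphM /= sc s1 s1' s2 -hw1 hw /wronskian; field.
  by [].
have sW : s W = W.
  elim/poly_ind: V => [|p c IH]; first by rewrite evp0 rmorph0.
  by rewrite evpD evpM evpX evpC rmorphD rmorphM /= IH sx sc.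
have [hD [Dx [Dc [h1 [h2 [_ [_ hgen]]]]]]] := hy.
have [_ [_ [_ [h1z [h2z _]]]]] := hz.
exists s; split=> //; split=> //; split=> //; apply: hgen.
- split; first by move=> a b ha hb; rewrite rmorphB !(derivationB hD) rmorphB ha hb.
  split; first by move=> a b ha hb; rewrite rmorphM !hD.2 rmorphD !rmorphM ha hb.
  move=> a ha; have [a0|a0] := eqVneq a 0; first by rewrite a0 invr0 !(derivation0 hD, rmorph0).
  have DV b : b != 0 -> D b^-1 = - D b / b ^+ 2.
    move=> b0; rewrite -[b^-1]mul1r derivation_frac // (derivation1 hD) mul0r mul1r sub0r.
    by [].
  by rewrite fmorphV !DV ?fmorph_eq0 // fmorph_div rmorphN rmorphXn /= ha.
- by move=> c; rewrite Dc sc Dc rmorph0.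
- by rewrite Dx sx Dx rmorph1.
- by rewrite s1' s1.
- by rewrite s2' s2.
- by rewrite h1 rmorphM /= sW s1 s1' h1z.
- by rewrite h2 rmorphM /= sW s2 s2' h2z.
Qed.

End Extension.
End GaloisExtension.

Section Group.
Variables (C : numClosedFieldType) (L : fieldType) (iota : {rmorphism C -> L}).
Variables (D : L -> L) (x : L) (V : {poly C}) (k : nat).
Hypotheses (mV : V \is monic) (sV : size V = k.+1) (k0 : (0 < k)%N).
Variables (K : fieldType) (j : {rmorphism K -> L}) (d : K -> K) (e : {rmorphism {poly C} -> K}).
Hypotheses (hd : derivation d) (hj : forall a, D (j a) = j (d a)).
Hypotheses (je : forall p, j (e p) = evp iota x p) (de : forall p, d (e p) = e p^`()).
Hypotheses (e_inj : injective e) (e_frac : forall z, exists p q, q != 0 /\ z = e p / e q).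
Local Notation W := (evp iota x V).
Local Notation PV := (PV_ext iota D x W).
Local Notation wr := (wronskian D).
Local Notation galois := (differential_galois iota D x).
Local Notation riccati r := (d r = e V - r ^+ 2).

Lemma base_char0 n : n.+1%:R != 0 :> K.
Proof. by rewrite -(rmorph_nat e) -(rmorph0 e) (inj_eq e_inj) -polyC_natr polyC_eq0 pnatr_eq0. Qed.

Lemma base_no_invariant N (P : {poly K}) : (0 < N)%N ->
  dext d ((e V)%:P - 'X^2) P + N%:R * 'X * P = 0 -> P = 0.
Proof. by move=> N0; apply: (rational_no_invariant e_inj hd de e_frac mV sV k0 N0). Qed.

Lemma base_constant c : j (e c%:P) = iota c.
Proof. by rewrite je evpC. Qed.

Lemma riccati_of_solution y1 y2 : PV y1 y2 -> D (D y1 / y1) = j (e V) - (D y1 / y1) ^+ 2.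
Proof.
move=> hy; have y0 := PV_nonzero hy; have [hD [_ [_ [h1 _]]]] := hy.
by rewrite derivation_frac // h1 je; field.
Qed.

Lemma galois_transitive y1 y2 z1 z2 : (forall r, ~ riccati r) ->
  PV y1 y2 -> PV z1 z2 -> wr y1 y2 = wr z1 z2 ->
  exists s : {rmorphism L -> L}, galois s /\ s y1 = z1 /\ s y2 = z2.
Proof.
move=> hno hy hz hw; have hD : derivation D := hy.1.
have no_stable (q : {poly K}) :
    q %| dext d ((e V)%:P - 'X^2) q -> q != 0 -> size q = 1%N.
  move=> hq q0; have [s1|] := leqP (size q) 1.
    by apply/eqP; rewrite eqn_leq s1 size_poly_gt0.
  move=> s1; have [r hr] := stable_riccati hd base_char0 base_no_invariant s1 hq.
  by case: (hno r).
have tower u1 u2 : PV u1 u2 ->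
    injective (evp (evp (evp j (D u1 / u1)) u1) (u2 / u1)).
  move=> hu; have u0 := PV_nonzero hu; have [w w0 hw1] := PV_wronskian hu.
  apply: (riccati_tower_injective hd hD hj base_char0 (w := e w%:P) _
    (riccati_of_solution hu) u0 _ _ no_stable).
  - by rewrite -(fmorph_eq0 j) base_constant fmorph_eq0.
  - by rewrite divfK.
  - by rewrite derivation_ratio // hw1 base_constant.
apply: (galois_extension (rx := (e 'X)%:P) (ru := 'X) hy hz hw _ _ _ _ _ (tower _ _ hy) (tower _ _ hz)).
- by move=> c; exists (e c%:P)%:P; rewrite /= !evpC base_constant.
- by rewrite /= evpC je evpX.
- by rewrite /= evpC je evpX.
- by rewrite /= evpX divfK // (PV_nonzero hy).
- by rewrite /= evpX divfK // (PV_nonzero hz).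
Qed.

Lemma galois_transitive_exponential r y1 y2 z1 z2 : riccati r ->
  PV y1 y2 -> PV z1 z2 -> D y1 = j r * y1 -> D z1 = j r * z1 -> wr y1 y2 = wr z1 z2 ->
  exists s : {rmorphism L -> L}, galois s /\ s y1 = z1 /\ s y2 = z2.
Proof.
move=> hr hy hz hy1 hz1 hw; have hD : derivation D := hy.1.
have tower u1 u2 : PV u1 u2 -> D u1 = j r * u1 -> injective (evp (evp j u1) (u2 / u1)).
  move=> hu hu1; have u0 := PV_nonzero hu; have [w w0 hw1] := PV_wronskian hu.
  apply: (rational_tower_injective hd hD hj base_char0 (w := e w%:P) _ _ hr u0 hu1 _
    base_no_invariant).
  - by rewrite -(fmorph_eq0 j) base_constant fmorph_eq0.
  - by rewrite de derivC rmorph0.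
  - by rewrite derivation_ratio // hw1 base_constant.
apply: (galois_extension (f := j) (g := j) (rx := e 'X) (ru := r) hy hz hw _ _ _ _ _
  (tower _ _ hy hy1) (tower _ _ hz hz1)) => //.
- by move=> c; exists (e c%:P); rewrite base_constant.
- by rewrite je evpX.
- by rewrite je evpX.
Qed.

Lemma galmat_det y1 y2 M : PV y1 y2 -> galmat iota D x y1 y2 M -> \det M = 1.
Proof.
move=> hy /galmatP[s [[_ [sD [_ sc]]] h]]; have [hD [_ [hc _]]] := hy.
have [w w0 hw] := PV_wronskian hy.
have /(wronskianM hD hc) : pair_row (s y1) (s y2) = pair_row y1 y2 *m map_mx iota M.
  by rewrite -h; apply/rowP; apply: ord2_ind; rewrite !mxE.
have -> : wr (s y1) (s y2) = s (wr y1 y2) by rewrite /wronskian rmorphB !rmorphM /= !sD.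
rewrite hw sc -[LHS]mulr1 => /mulfI h1; apply: (fmorph_inj iota); rewrite rmorph1 -h1 //.
by rewrite fmorph_eq0.
Qed.

Lemma PV_image y1 y2 (M : 'M[C]_2) : PV y1 y2 -> \det M = 1 ->
  exists z1 z2, [/\ pair_row z1 z2 = pair_row y1 y2 *m map_mx iota M,
    PV z1 z2 & wr y1 y2 = wr z1 z2].
Proof.
move=> hy dM; have [hD [_ [hc _]]] := hy.
have uM : M \in unitmx by rewrite unitmxE dM unitr1.
set Z := pair_row y1 y2 *m map_mx iota M.
have hz : pair_row (Z 0 ord0) (Z 0 ord_max) = Z := pair_row_eta Z.
exists (Z 0 ord0), (Z 0 ord_max); split=> //; first exact: (PV_basis_change uM hz hy).
by rewrite (wronskianM hD hc hz) dM rmorph1 mulr1.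
Qed.

Lemma galmat_of_image y1 y2 z1 z2 (M : 'M[C]_2) (s : {rmorphism L -> L}) :
  pair_row z1 z2 = pair_row y1 y2 *m map_mx iota M -> galois s -> s y1 = z1 -> s y2 = z2 ->
  galmat iota D x y1 y2 M.
Proof.
move=> hz hs h1 h2; apply/galmatP; exists s; split=> //; rewrite -hz.
by apply/rowP; apply: ord2_ind; rewrite !mxE /= ?h1 ?h2.
Qed.

Lemma galmat_SL2 y1 y2 M : (forall r, ~ riccati r) -> PV y1 y2 ->
  galmat iota D x y1 y2 M <-> \det M = 1.
Proof.
move=> hno hy; split=> [|dM]; first exact: galmat_det.
have [z1 [z2 [hz hPz hw]]] := PV_image hy dM.
have [s [hs [h1 h2]]] := galois_transitive hno hy hPz hw.
exact: galmat_of_image hz hs h1 h2.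
Qed.

Lemma galmat_Borel r y1 y2 M : riccati r -> PV y1 y2 -> D y1 = j r * y1 ->
  galmat iota D x y1 y2 M <-> @Borel C M.
Proof.
move=> hr hy hy1; have [hD [_ [hc [_ [_ [w0 _]]]]]] := hy.
have sr (s : {rmorphism L -> L}) : galois s -> s (j r) = j r.
  move=> [_ [_ [sx sc]]].
  have se p : s (j (e p)) = j (e p).
    rewrite je; elim/poly_ind: p => [|p c IH]; first by rewrite evp0 rmorph0.
    by rewrite evpD evpM evpX evpC rmorphD rmorphM /= IH sx sc.
  by have [p [q [_ ->]]] := e_frac r; rewrite !fmorph_div /= !se.
split=> [hM|].
  rewrite /Borel (galmat_det hy hM) eqxx /=.
  have /galmatP[s [hs h]] := hM; have [_ [sD _]] := hs.
  have := congr1 (fun Z : 'rV[L]_2 => Z 0 ord0) h; rewrite pair_rowM !mxE /= => h1.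
  have : D (s y1) = j r * s y1 by rewrite -sD hy1 rmorphM /= sr.
  rewrite h1 hD.1 !hD.2 !hc !mulr0 !addr0 hy1 => h2.
  have : iota (M ord_max ord0) * (y1 * D y2 - D y1 * y2) = 0.
    have -> : iota (M ord_max ord0) * (y1 * D y2 - D y1 * y2) =
      y1 * (j r * y1 * iota (M ord0 ord0) + D y2 * iota (M ord_max ord0) -
        j r * (y1 * iota (M ord0 ord0) + y2 * iota (M ord_max ord0))) by rewrite hy1; ring.
    by rewrite h2 subrr mulr0.
  by move/eqP; rewrite mulf_eq0 (negPf w0) orbF fmorph_eq0.
move=> /andP[/eqP dM /eqP M10].
have [z1 [z2 [hz hPz hw]]] := PV_image hy dM.
have hz1 : D z1 = j r * z1.
  have := congr1 (fun Z : 'rV[L]_2 => Z 0 ord0) hz; rewrite pair_rowM !mxE /= M10 => ->.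
  by rewrite rmorph0 mulr0 addr0 hD.2 hc hy1; ring.
have [s [hs [h1 h2]]] := galois_transitive_exponential hr hy hPz hy1 hz1 hw.
exact: galmat_of_image hz hs h1 h2.
Qed.

Lemma riccati_basis r y1 y2 : riccati r -> PV y1 y2 ->
  exists (Q : 'M[C]_2) z1 z2, [/\ Q \in unitmx,
    pair_row z1 z2 = pair_row y1 y2 *m map_mx iota Q & D z1 = j r * z1].
Proof.
move=> hr hy; have [hD [_ [hc [h1 [h2 [w0 [hconst _]]]]]]] := hy.
have hv y : D (D y) = W * y -> D (D y - j r * y) = - j r * (D y - j r * y).
  by move=> hyy; rewrite (derivationB hD) hD.2 hj hyy hr rmorphB rmorphXn /= je; ring.
have [v10|v10] := eqVneq (D y1 - j r * y1) 0.
  exists 1%:M, y1, y2; rewrite unitmx1 map_mx1 mulmx1; split=> //.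
  by apply/eqP; rewrite -subr_eq0 v10.
have [|c hc1] := hconst ((D y2 - j r * y2) / (D y1 - j r * y1)).
  by rewrite derivation_frac // !hv //; field.
pose Q : 'M[C]_2 := \matrix_(i, l)
  if l == ord0 then (if i == ord0 then - c else 1) else (if i == ord0 then 1 else 0).
exists Q, (y2 - iota c * y1), y1; split.
- by rewrite unitmxE det_mx2 !mxE /= mulr0 mul1r sub0r unitrN unitr1.
- by apply/rowP; apply: ord2_ind; rewrite pair_rowM !mxE /= ?rmorphN ?rmorph1 ?rmorph0; ring.
- rewrite (derivationB hD) hD.2 hc mul0r add0r -hc1.
  apply/eqP; rewrite -subr_eq0; apply/eqP; field.
  by [].
Qed.

End Group.

(** * The eigenring *)

Section OperatorProduct.
Variables (L : fieldType) (D : L -> L).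
Hypothesis hD : derivation D.

Lemma iter_derivation0 k : iter k D 0 = 0.
Proof. by elim: k => //= k ->; rewrite derivation0. Qed.

Lemma opmul_widen (P Q : {poly L}) n m : (size P <= n)%N -> (size Q <= m)%N ->
  opmul D P Q = \sum_(i < n) \sum_(l < m) \sum_(k < i.+1)
     (('C(i, k))%:R * P`_i * iter k D Q`_l) *: 'X^(i + l - k).
Proof.
move=> hn hm; rewrite /opmul.
rewrite (big_ord_widen n (fun i => \sum_(l < size Q) \sum_(k < i.+1)
  (('C(i, k))%:R * P`_i * iter k D Q`_l) *: 'X^(i + l - k)) hn) big_mkcond /=.
apply: eq_bigr => i _; case: ltnP => hi.
  rewrite (big_ord_widen m (fun l => \sum_(k < i.+1)
    (('C(i, k))%:R * P`_i * iter k D Q`_l) *: 'X^(i + l - k)) hm) big_mkcond /=.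
  apply: eq_bigr => l _; case: ltnP => // hl; rewrite big1 // => k _.
  by rewrite (nth_default _ hl) iter_derivation0 mulr0 scale0r.
rewrite big1 // => l _; rewrite big1 // => k _.
by rewrite (nth_default _ hi) mulr0 mul0r scale0r.
Qed.

Variable w : L.
Local Notation Lop := (- 'X^2 + w%:P).

Lemma size_schrodinger : (size (Lop : {poly L}) <= 3)%N.
Proof. by apply/leq_sizeP => -[|[|[|i]]] // _; rewrite coefD coefN coefXn coefC oppr0 addr0. Qed.

Lemma sum_ord3 (F : nat -> {poly L}) : \sum_(l < 3) F l = F 0%N + F 1%N + F 2%N.
Proof. by rewrite !big_ord_recl big_ord0 addr0 addrA. Qed.

Lemma opmul_schrodingerE (S : {poly L}) : opmul D S Lop =
  \sum_(i < size S) \sum_(k < i.+1) (('C(i, k))%:R * S`_i * iter k D w) *: 'X^(i - k)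
   - S * 'X^2.
Proof.
rewrite (opmul_widen (leqnn _) size_schrodinger).
have -> : S * 'X^2 = \sum_(i < size S) S`_i *: 'X^(i + 2).
  by rewrite -{1}[S]coefK poly_def mulr_suml; apply: eq_bigr => i _; rewrite -scalerAl exprD.
rewrite -sumrB; apply: eq_bigr => i _.
rewrite (sum_ord3 (fun l => \sum_(k < i.+1)
  (('C(i, k))%:R * S`_i * iter k D (Lop : {poly L})`_l) *: 'X^(i + l - k))).
rewrite !coefD !coefN !coefXn !coefC /= !oppr0 !add0r !addr0 -addrA.
congr (_ + _); first by apply: eq_bigr => k _; rewrite addn0.
rewrite [X in X + _]big1 ?add0r => [|k _]; last by rewrite iter_derivation0 mulr0 scale0r.
rewrite big_ord_recl big1 ?addr0 => [|k _] /=.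
  by rewrite bin0 mul1r subn0 mulrN1 scaleNr.
by rewrite -iterS iterSr (derivationN hD) (derivation1 hD) oppr0 iter_derivation0 mulr0 scale0r.
Qed.

Lemma schrodinger_commutation (R S : {poly L}) : (size R <= 2)%N ->
  opmul D Lop R = opmul D S Lop ->
  2%:R * D R`_0 + D (D R`_1) = 0 /\
  D (D R`_0) + 2%:R * w * D R`_1 + R`_1 * D w = 0.
Proof.
move=> sR eRS.
have D0 := derivation0 hD; have D1 := derivation1 hD; have DN := derivationN hD.
have eL : opmul D Lop R = (w * R`_0 - D (D R`_0))%:P + (w * R`_1 - 2%:R * D R`_0 - D (D R`_1)) *: 'X
   - (R`_0 + 2%:R * D R`_1) *: 'X^2 - R`_1 *: 'X^3.
  rewrite (opmul_widen size_schrodinger sR).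
  rewrite (sum_ord3 (fun i => \sum_(l < 2) \sum_(k < i.+1)
    (('C(i, k))%:R * (Lop : {poly L})`_i * iter k D R`_l) *: 'X^(i + l - k))).
  rewrite !big_ord_recl !big_ord0 /= !coefD !coefN !coefXn !coefC /=.
  have -> : bump 0 0 = 1%N by []. have -> : bump 0 1 = 2%N by [].
  rewrite !(oppr0, addr0, add0r, mulr0, mul0r, scale0r) !bin0 bin1 !binn.
  rewrite !addn0 !add0n !subn0 addnK addKn subnn addn1.
  have -> : (2 - 1 = 1)%N by [].
  by rewrite -!mul_polyC !(polyCD, polyCN, polyCM, polyCB) polyC_natr expr0 expr1; ring.
have sS : (size S <= 2)%N.
  rewrite leqNgt; apply/negP => s3.
  have S0 : S != 0 by rewrite -size_poly_gt0; apply: leq_trans s3.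
  set T := \sum_(i < size S) \sum_(k < i.+1) (('C(i, k))%:R * S`_i * iter k D w) *: 'X^(i - k).
  have eS : S * 'X^2 = T - opmul D Lop R by rewrite eRS opmul_schrodingerE -/T; ring.
  have sT : (size T <= size S)%N.
    apply: (leq_trans (size_sum _ _ _)); apply/bigmax_leqP => i _.
    apply: (leq_trans (size_sum _ _ _)); apply/bigmax_leqP => l _.
    apply: leq_trans (size_scale_leq _ _) _; rewrite size_polyXn.
    by apply: leq_ltn_trans (leq_subr _ _) (ltn_ord i).
  have sL : (size (opmul D Lop R) <= 4)%N.
    rewrite eL; apply/leq_sizeP => -[|[|[|[|i]]]] // _.
    by rewrite !coefB !coefD !coefZ !coefXn coefX coefC /= !mulr0 !subr0 addr0.
  have : (size (S * 'X^2)%R <= maxn (size S) 4)%N.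
    rewrite eS; apply: leq_trans (size_polyD _ _) _; rewrite size_polyN geq_max.
    by rewrite !leq_max sT sL orbT.
  rewrite size_mulXn // leq_max => /orP[|]; first by rewrite -{2}[size S]add0n leq_add2r.
  by move=> h; have := leq_trans (_ : 2 + 3 <= 2 + size S)%N h; rewrite leq_add2l => /(_ s3).
have := eRS; rewrite eL (opmul_widen sS size_schrodinger) !big_ord_recl !big_ord0 /=.
rewrite !coefD !coefN !coefXn !coefC /=.
have -> : bump 0 0 = 1%N by []. have -> : bump 0 1 = 2%N by [].
rewrite !(oppr0, addr0, add0r, mulr0, mul0r, scale0r, D0, DN, D1) !bin0 !binn.
rewrite !addn0 !add0n !subn0 subnn add1n !mul1r !mulrN1 => h.
have hc i := congr1 (fun p : {poly L} => p`_i) h.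
have := hc 0%N; have := hc 1%N; have := hc 2%N; have := hc 3%N.
rewrite !(coefN, coefD, coefZ, coefXn, coefX, coefC) /=.
rewrite !(mulr0, mulr1, subr0, addr0, add0r, sub0r, oppr0).
move=> /oppr_inj <- /oppr_inj <- h1 h0; split.
  have -> : 2%:R * D R`_0 + D (D R`_1) = w * R`_1 - (w * R`_1 - 2%:R * D R`_0 - D (D R`_1)) by ring.
  by rewrite h1; ring.
have -> : D (D R`_0) = w * R`_0 - (w * R`_0 - D (D R`_0)) by ring.
by rewrite h0; ring.
Qed.

End OperatorProduct.

Section Eigenring.
Variables (C : numClosedFieldType) (L : fieldType) (iota : {rmorphism C -> L}).
Variables (D : L -> L) (x : L) (V : {poly C}) (k : nat).
Hypotheses (mV : V \is monic) (sV : size V = k.+1) (k0 : (0 < k)%N).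
Variables (K : fieldType) (j : {rmorphism K -> L}) (d : K -> K) (e : {rmorphism {poly C} -> K}).
Hypotheses (hd : derivation d) (hj : forall a, D (j a) = j (d a)).
Hypotheses (je : forall p, j (e p) = evp iota x p) (de : forall p, d (e p) = e p^`()).
Hypotheses (e_inj : injective e) (e_frac : forall z, exists p q, q != 0 /\ z = e p / e q).
Hypothesis (hD : derivation D) (constants : forall z, D z = 0 -> exists c, z = iota c).

Lemma inK_base z : inK iota x z -> exists a, z = j a.
Proof.
move=> [p [q [_ ->]]]; exists (e p / e q).
by rewrite fmorph_div /= !je.
Qed.

Lemma eigenring_schrodinger : eigenring_trivial iota D x (- 'X^2 + (evp iota x V)%:P).
Proof.
move=> R sR hR [S [_ hS]].
have [h1 h2] := schrodinger_commutation hD sR hS.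
have [a ha] := inK_base (hR 0%N); have [b hb] := inK_base (hR 1%N).
rewrite ha hb -je !hj in h1 h2.
have {}h1 : 2%:R * d a + d (d b) = 0.
  by apply: (fmorph_inj j); rewrite rmorph0 -[RHS]h1 rmorphD rmorphM rmorph_nat.
have {}h2 : d (d a) + 2%:R * e V * d b + b * d (e V) = 0.
  by apply: (fmorph_inj j); rewrite rmorph0 -[RHS]h2 !rmorphD !rmorphM rmorph_nat.
pose P : {poly K} := b%:P * 'X^2 - (d b)%:P * 'X - (d a + e V * b)%:P.
have P0 : P = 0.
  apply: (base_no_invariant mV sV k0 hd de e_inj e_frac (N := 2)) => //.
  have hDD := dext_derivation hd ((e V)%:P - 'X^2).
  rewrite /P !(derivationB hDD) !hDD.2 !dextX // !dextC // hd.1 hd.2.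
  have e1 : (d (d b))%:P = - (2%:R * (d a)%:P) :> {poly K}.
    rewrite -polyC_natr -polyCM -polyCN; congr (_%:P).
    by apply/eqP; rewrite -addr_eq0 addrC h1.
  have e2 : (d (d a))%:P = - (2%:R * (e V)%:P * (d b)%:P + b%:P * (d (e V))%:P) :> {poly K}.
    rewrite -polyC_natr -!polyCM -polyCD -polyCN; congr (_%:P).
    by apply/eqP; rewrite -addr_eq0 addrA h2.
  by rewrite !(polyCD, polyCM) e1 e2; ring.
have b0 : b = 0.
  have := congr1 (fun p : {poly K} => p`_2) P0.
  by rewrite /P !coefB !coefCM coefXn coefX !coefC /= mulr0 mulr1 !subr0.
have da0 : d a = 0.
  move/eqP: h1; rewrite b0 !(derivation0 hd) addr0 mulf_eq0.
  by rewrite (negPf (base_char0 e_inj 1)) => /eqP.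
have [|c hc] := constants (z := R`_0); first by rewrite ha hj da0 rmorph0.
exists c; apply/polyP => -[|[|i]]; rewrite coefC //=; first by rewrite hb b0 rmorph0.
by rewrite nth_default // (leq_trans sR).
Qed.

End Eigenring.

Lemma conj_to_SL2 (C : numClosedFieldType) (G : 'M[C]_2 -> Prop) :
  (forall M, G M <-> \det M = 1) -> conj_to G (@SL2 C).
Proof.
move=> hG; exists 1%:M; rewrite unitmx1; split=> // M; rewrite hG; split.
  by move=> h; exists M; rewrite ?invmx1 ?mul1mx ?mulmx1 // /SL2 h.
by move=> [A /eqP hA ->]; rewrite invmx1 mul1mx mulmx1.
Qed.

Lemma conj_to_Borel_SL2 (C : numClosedFieldType) (G : 'M[C]_2 -> Prop) :
  (forall M, G M <-> \det M = 1) -> ~ conj_to G (@Borel C).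
Proof.
move=> hG [P [uP hP]].
pose A : 'M[C]_2 := \matrix_(i, l) (if (i == ord0) && (l == ord_max) then 0 else 1).
have dA : \det A = 1 by rewrite det_mx2 !mxE /= mul0r mul1r subr0.
have : G (invmx P *m A *m P).
  by rewrite hG !det_mulmx dA mulr1 mulrC det_inv mulrV.
case/hP => B /andP[_ /eqP B0] /(congr1 (mulmx P)).
rewrite !mulmxA mulmxV // !mul1mx => /(congr1 (mulmx^~ (invmx P))); rewrite !mulmxK // => AB.
by move: B0; rewrite -AB mxE /= => /eqP; rewrite oner_eq0.
Qed.

Lemma monic_subC (C : numClosedFieldType) (V : {poly C}) (lam : C) k :
  V \is monic -> size V = k.+1 -> (0 < k)%N ->
  V - lam%:P \is monic /\ size (V - lam%:P) = k.+1.
Proof.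
move=> mV sV k0.
have lt : (size (- lam%:P : {poly C}) < size V)%N.
  by rewrite size_polyN sV; apply: leq_ltn_trans (size_polyC_leq1 _) _.
by rewrite monicE lead_coefDl // size_polyDl // -monicE.
Qed.

Lemma case1_riccati (C : numClosedFieldType) (V : {poly C}) lam k n (A B : {poly C}) m P :
  cond1 V lam k n A B -> case1 n m A B P -> riccati_poly (V - lam%:P) A P.
Proof.
move=> [_ [_ [_ [_ hV]]]] [_ [_ [_ hP]]]; rewrite /riccati_poly hV -[RHS]hP; ring.
Qed.

Lemma case2_riccati (C : numClosedFieldType) (V : {poly C}) lam k n (A B : {poly C}) m P :
  cond1 V lam k n A B -> case2 n m A B P -> riccati_poly (V - lam%:P) (- A) P.
Proof.
move=> [_ [_ [_ [_ hV]]]] [_ [_ [_ hP]]]; rewrite /riccati_poly hV -[RHS]hP derivN; ring.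
Qed.

Theorem theorem2p2p2 (C : numClosedFieldType) (L : fieldType)
    (iota : {rmorphism C -> L}) (D : L -> L) (x y1 y2 : L)
    (V : {poly C}) (k : nat) (lam : C) :
  V \is monic -> size V = k.+1 -> (0 < k)%N ->
  PV_ext iota D x (map_poly iota (V - lam%:P)).[x] y1 y2 ->
  (conj_to (galmat iota D x y1 y2) (@SL2 C) \/ conj_to (galmat iota D x y1 y2) (@Borel C))
  /\ eigenring_trivial iota D x (- 'X^2 + ((map_poly iota (V - lam%:P)).[x])%:P)
  /\ (conj_to (galmat iota D x y1 y2) (@Borel C) <->
      exists n (A B : {poly C}) m (P : {poly C}),
        cond1 V lam k n A B /\ (case1 n m A B P \/ case2 n m A B P))
  /\ (forall n (A B : {poly C}) m (P : {poly C}), cond1 V lam k n A B ->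
        case1 n m A B P ->
        exists E : L, E != 0 /\ D E = (map_poly iota A).[x] * E /\
          D (D ((map_poly iota P).[x] * E)) =
            (map_poly iota (V - lam%:P)).[x] * ((map_poly iota P).[x] * E))
  /\ (forall n (A B : {poly C}) m (P : {poly C}), cond1 V lam k n A B ->
        case2 n m A B P ->
        exists E : L, E != 0 /\ D E = - (map_poly iota A).[x] * E /\
          D (D ((map_poly iota P).[x] * E)) =
            (map_poly iota (V - lam%:P)).[x] * ((map_poly iota P).[x] * E)).
Proof.
move=> mV0 sV0 k0; have [mV sV] := monic_subC lam mV0 sV0 k0.
rewrite -!/(evp iota x (V - lam%:P)); set W := V - lam%:P in mV sV * => hy.
have [hD [Dx [hc [_ [_ [_ [hconst _]]]]]]] := hy.
have [K [j [d [e [[hd hj je de e_inj] e_frac]]]]] := base_field hD Dx hc.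
have Devp p : D (evp iota x p) = evp iota x p^`() by rewrite -!je hj de.
have Borel_of_riccati r : d r = e W - r ^+ 2 -> conj_to (galmat iota D x y1 y2) (@Borel C).
  move=> hr; have [Q [z1 [z2 [uQ hz hz1]]]] := riccati_basis hj je hr hy.
  have hPz := PV_basis_change uQ hz hy.
  have hG M := galmat_conj D x M uQ hz.
  exists (invmx Q); rewrite unitmx_inv uQ; split=> // M.
  rewrite hG (galmat_Borel mV sV k0 hd hj je de e_inj e_frac _ hr hPz hz1); split=> [h|].
    by exists (invmx Q *m M *m Q) => //; rewrite invmxK !mulmxA mulmxV // mul1mx mulmxK.
  by move=> [A hA ->]; rewrite invmxK !mulmxA mulVmx // mul1mx mulmxKV.
have SL2_of_none : (forall r, d r <> e W - r ^+ 2) ->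
    forall M, galmat iota D x y1 y2 M <-> \det M = 1.
  move=> hno M; exact: (galmat_SL2 mV sV k0 hd hj je de e_inj e_frac M hno hy).
have riccati_dec : (exists r, d r = e W - r ^+ 2) \/ (forall r, d r <> e W - r ^+ 2).
  have [h|h] := pselect (exists r, d r = e W - r ^+ 2); first by left.
  by right=> r hr; apply: h; exists r.
have solution S P : P != 0 -> riccati_poly W S P -> exists E : L, E != 0 /\
    D E = evp iota x S * E /\ D (D (evp iota x P * E)) = evp iota x W * (evp iota x P * E).
  move=> P0 hP; have hr := riccati_of_poly hd de e_inj P0 hP.
  have [Q [z1 [z2 [uQ hz hz1]]]] := riccati_basis hj je hr hy.
  have hPz := PV_basis_change uQ hz hy; have z10 := PV_nonzero hPz.
  have eP0 : evp iota x P != 0 by rewrite -je fmorph_eq0 -(rmorph0 e) (inj_eq e_inj).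
  have [_ [_ [_ [hz1' _]]]] := hPz.
  exists (z1 / evp iota x P); split; first by rewrite mulf_neq0 // invr_eq0.
  split; last by rewrite mulrC divfK.
  rewrite derivation_frac // hz1 Devp rmorphD fmorph_div /= !je; field.
  by [].
split.
  have [[r hr]|hno] := riccati_dec; first by right; apply: Borel_of_riccati hr.
  by left; apply: conj_to_SL2; apply: SL2_of_none.
split; first exact: (eigenring_schrodinger mV sV k0 hd hj je de e_inj e_frac hD hconst).
split; last first.
  split=> n A B m P h1 h2.
    by have [_ [mP _]] := h2; apply: (solution A P (monic_neq0 mP) (case1_riccati h1 h2)).
  have [_ [mP _]] := h2.
  have := solution _ P (monic_neq0 mP) (case2_riccati h1 h2).
  by rewrite -sub0r evpB evp0 sub0r.
split=> [hB|[n [A [B [m [P [h1 h2]]]]]]].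
  have [[r hr]|hno] := riccati_dec; last by case: (conj_to_Borel_SL2 (SL2_of_none hno) hB).
  have [S [P [mP hP]]] := poly_of_riccati hd de e_inj e_frac hr.
  have [n [A [B [m [kn [mA [sA [sB [hW [sP hcase]]]]]]]]]] := riccati_poly_cases mV sV k0 mP hP.
  exists n, A, B, m, P; split; first by do !split=> //.
  have eW : W - A ^+ 2 = B by rewrite hW; ring.
  case: hcase => -[eS hB']; [left|right]; do !split=> //.
    by rewrite -[RHS]hP /riccati_poly eS hW; ring.
  by rewrite -[RHS]hP /riccati_poly eS hW derivN; ring.
case: h2 => h2; have [_ [mP _]] := h2.
  exact: Borel_of_riccati (riccati_of_poly hd de e_inj (monic_neq0 mP) (case1_riccati h1 h2)).
exact: Borel_of_riccati (riccati_of_poly hd de e_inj (monic_neq0 mP) (case2_riccati h1 h2)).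
Qed.
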